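(* For each $n\in\mathbb N$, let $\bm X_1^{(n)},\dots,\bm X_n^{(n)}$ be an i.i.d. sample from a $d_n$-variate random vector $\bm X^{(n)}$ with continuous marginal cdfs whose stable tail dependence function exists and equals $L^{(n)}(\bm x)=\sum_{a\in[K_n]}\max_{j\in[d_n]}\bar A^{(n)}_{ja}x_j$, $\bm x\in[0,\infty)^{d_n}$, for some unknown $(K_n,\bar A^{(n)})\in\Theta_L(d_n)$; all random variables are defined on the same probability space. Assume that $d=d_n\ge2$ satisfies $\ln(d_n)=o(n)$, that there exist $\rho_0>0$ and $M_0>0$ such that, for all $n$ and all $1\le j<\ell\le d_n$, the bivariate copula $C^{(n)}_{j,\ell}$ of $(X^{(n)}_j,X^{(n)}_\ell)$ belongs to $\bigcup_{\rho\ge\rho_0}\bigcup_{M\in[0,M_0]}\mathfrak X(\rho,M)$, and that $\liminf_{n\to\infty}\eta_n>0$, where $\eta_n=\eta(\bar A^{(n)})$. Then, for any $r=r_n\in[\rho_0,\infty)$ and $M=M_n\in(0,M_0]$ such that $C^{(n)}_{j,\ell}\in\mathfrak X(r_n,M_n)$ for all $1\le j<\ell\le d_n$, choosing $$k=\Big\lfloor c_k\,(\ln(4dn^2))^{\frac1{2r+1}}\,n^{\frac{2r}{2r+1}}\Big\rfloor\qquad\text{and}\qquad\kappa=\bar\kappa=c_\kappa\Big(\frac{\ln(4dn^2)}n\Big)^{\frac r{2r+1}}$$ for some $c_k=c_k(n)>0$ and $c_\kappa=c_\kappa(n)>0$ that are bounded away from zero and infinity and satisfy $c_\kappa\ge Mc_k^r+9c_k^{-1/2}+5c_k^{-1}$,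 we have $$\mathbb P\big\{\hat I_n=I_n,\ \hat K_n=K_n,\ \hat s_n=s_n\text{ for all but finitely many }n\big\}=1$$ and $$L_{\infty,2}(\widehat A,\bar A)=O_{\mathrm{a.s.}}\Big(\sqrt{s}\,\Big(\frac{\ln(nd)}n\Big)^{\frac r{2r+1}}\Big),$$ where $\bar A=\bar A^{(n)}$, $s=s_n$, and $\hat K_n,\hat I_n,\hat s_n$ and $\widehat A=\widehat A^{(n)}$ are the outputs of the PureVar and HTSP algorithms applied to $\bm X_1^{(n)},\dots,\bm X_n^{(n)}$ with tuning parameters $k,\kappa,\bar\kappa$.
   Context: Notation: $[m]=\{1,\dots,m\}$, $x\wedge y=\min(x,y)$; $A_{j\cdot}$ is the $j$th row of $A$; $\operatorname{supp}(\bm w)=\{a:w_a>0\}$. $O_{\mathrm{a.s.}}(v_n)$ denotes a sequence whose ratio to $v_n$ has almost surely finite limsup. Stable tail dependence function of a $d$-variate vector $\bm X$ with continuous marginal cdfs $F_1,\dots,F_d$: $L(\bm x)=\lim_{n\to\infty}n\,\mathbb P\{F_1(X_1)>1-x_1/n\text{ or }\dots\text{ or }F_d(X_d)>1-x_d/n\}$, $\bm x\in[0,\infty)^d$. Parameter space: $\Theta_L(d)$ is the set of pairs $(K,\bar A)$ with $K\in[d]$ and $\bar A\in[0,\infty)^{d\times K}$ having all row sums equal to $1$ and satisfying the pure variable assumption: for each $a\in[K]$ the set $I_a=\{j\in[d]:\bar A_{ja}>0\text{ and }\bar A_{jb}=0\ \forall b\ne a\}$ is non-empty. The pure variable set is $I=\bigcup_{a\in[K]}I_a$;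 $I_n$ denotes that of $\bar A^{(n)}$. Row sparsity: $s(\bar A)=\max_{j\in[d]}|\{a\in[K]:\bar A_{ja}>0\}|$, $s_n=s(\bar A^{(n)})$. Signal strength: $\eta(\bar A)=\min\{\bar A_{ja}\wedge(1-\bar A_{ja}): j\in[d],a\in[K],\ \bar A_{ja}\notin\{0,1\}\}\in(0,1/2]$, with the convention $\eta=1/2$ if this set is empty. Second order classes: for a bivariate copula $C$ let $\bar C(u,v)=u+v-1+C(1-u,1-v)$ and $\chi_t=t\bar C(1/t,1/t)$, $t>1$. Let $\mathcal C_2$ be the set of bivariate copulas for which $\chi=\lim_{t\to\infty}\chi_t$ exists. For $\rho\in(0,\infty)$ and $M\in[0,\infty)$, $\mathfrak X(\rho,M)=\{C\in\mathcal C_2:\ |\chi_t-\chi|\le Mt^{-\rho}\text{ for all }t>1\}$. Empirical tail correlations of a $d$-variate sample of size $n$, with $k\in[n]$: $\hat\chi_{n,k}(j,\ell)=\frac1k\sum_{i=1}^n\mathbf 1(R_{i,j}>n-k,\ R_{i,\ell}>n-k)$, where $R_{i,j}$ is the rank of $X_{i,j}$ among $X_{1,j},\dots,X_{n,j}$ (ties broken at random). PureVar algorithm with tuning parameter $\kappa$: let $\hat G$ be the undirected graph on $[d]$ in which distinct $j,\ell$ are joined by an edge iff $\hat\chi_{n,k}(j,\ell)\le\kappa$. Choose a maximum clique (clique of maximal cardinality) $\hat C=\{\hat j_1,\dots,\hat j_{\hat K}\}$ of $\hat G$, $\hat K=|\hat C|$. For $a\in[\hat K]$ put $\hat I_a=\{\hat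 j_a\}\cup\{\ell\in[d]:\hat\chi_{n,k}(\hat j_a,\ell)\ge1-\kappa\}$; put $\hat I=\hat I_1\cup\dots\cup\hat I_{\hat K}$ and $\hat J=[d]\setminus\hat I$. HTSP estimator $\widehat A\in[0,1]^{d\times\hat K}$ with additional tuning parameter $\bar\kappa$: - For $j\in\hat I$, $\widehat A_{j\cdot}$ is the $a$th unit vector of $\mathbb R^{\hat K}$, where $a$ is the index with $j\in\hat I_a$. - For $j\in\hat J$, set $\widehat A^{(1)}_{ja}=|\hat I_a|^{-1}\sum_{\ell\in\hat I_a}\hat\chi_{n,k}(j,\ell)$ and $\widehat A^{(2)}_{ja}=\widehat A^{(1)}_{ja}\mathbf 1(\widehat A^{(1)}_{ja}>\bar\kappa)$ for $a\in[\hat K]$, and $\widehat A_{j\cdot}=\tilde{\mathcal P}(\widehat A^{(2)}_{j\cdot})$. (On outcomes where these prescriptions are not well defined, i.e. where the $\hat I_a$ overlap or a row $\widehat A^{(2)}_{j\cdot}$ vanishes, the affected rows may be defined arbitrarily.) Here, for $\bm w\in[0,1]^p$ with sorted components $w_{(1)}\ge\dots\ge w_{(p)}$, $\mathcal P(\bm w)=(\max(w_a-\tau(\bm w),0))_{a=1}^p$ with $\tau(\bm w)=\frac1\rho(-1+\sum_{b=1}^\rho w_{(b)})$ and $\rho=\max\{b\in[p]:w_{(b)}>\frac1b(\sum_{a=1}^bw_{(a)}-1)\}$; for $\bm w\ne\bm0$ with $S=\operatorname{supp}(\bm w)$, $\tilde{\mathcal P}(\bm w)$ equals $\mathcal P(\bm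 w|_S)$ on the coordinates in $S$ and $0$ elsewhere. Finally $\hat s=\max_{j\in[d]}|\operatorname{supp}(\widehat A_{j\cdot})|$. Loss: for $A\in\mathbb R^{d\times K}$ and $A'\in\mathbb R^{d\times K'}$, $L_{\infty,2}(A,A')=\min_P\|A-A'P\|_{\infty,2}$ (minimum over all $K\times K$ permutation matrices $P$) if $K=K'$, and $+\infty$ if $K\ne K'$, where $\|A\|_{\infty,2}=\max_{j\in[d]}\big(\sum_a|A_{ja}|^2\big)^{1/2}$. *)

(* Defs.v *)
From HB Require Import structures.
From mathcomp Require Import all_boot all_order all_algebra all_fingroup.
From mathcomp Require Import all_classical all_reals all_analysis.

Set Implicit Arguments.
Unset Strict Implicit.
Unset Printing Implicit Defensive.

Import Order.TTheory GRing.Theory Num.Theory.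
Import numFieldNormedType.Exports.

Local Open Scope classical_set_scope.
Local Open Scope ring_scope.

Section random_vectors.
Context {disp : measure_display} {Omega : measurableType disp} {R : realType}
  {P : probability Omega R}.

(* The type of tuples carries the product sigma-algebra. *)
Definition rvec (d : nat) (X : 'I_d -> {RV P >-> R}) (w : Omega) :
  d.-tuple (measurableTypeR R) := [tuple X j w | j < d].

(* Taking some of the B i to be the full set gives the product rule for every
   subfamily, so this is mutual independence of the n random vectors. *)
Definition independent_vectors (n d : nat)
    (Y : 'I_n -> 'I_d -> {RV P >-> R}) : Prop :=
  forall B : 'I_n -> set (d.-tuple (measurableTypeR R)),
    (forall i, measurable (B i)) ->
    P [set w | forall i, B i (rvec (Y i) w)]
      = (\prod_(i < n) P (rvec (Y i) @^-1` B i))%E.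

Definition same_law (d : nat) (X Y : 'I_d -> {RV P >-> R}) : Prop :=
  forall B : set (d.-tuple (measurableTypeR R)), measurable B ->
    P (rvec Y @^-1` B) = P (rvec X @^-1` B).

Definition iid_sample (n d : nat) (X : 'I_d -> {RV P >-> R})
    (Y : 'I_n -> 'I_d -> {RV P >-> R}) : Prop :=
  independent_vectors Y /\ forall i, same_law X (Y i).

Definition continuous_margins (d : nat) (X : 'I_d -> {RV P >-> R}) : Prop :=
  forall j, continuous (cdf (X j)).

(* The stable tail dependence function of X exists and equals L. *)
Definition has_stdf (d : nat) (X : 'I_d -> {RV P >-> R})
    (L : ('I_d -> R) -> R) : Prop :=
  forall x : 'I_d -> R, (forall j, 0 <= x j) ->
    (m%:R%:E * P [set w | exists j : 'I_d,
        (1 - x j / m%:R)%:E < cdf (X j) (X j w)])%E @[m --> \oo] --> (L x)%:E.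

End random_vectors.

Section copulas.
Context {R : realType}.
Implicit Types C : R -> R -> R.

(* Only the values of C on the unit square are relevant. *)
Definition is_copula C : Prop :=
  [/\ forall u, 0 <= u <= 1 -> C u 0 = 0 /\ C 0 u = 0,
      forall u, 0 <= u <= 1 -> C u 1 = u /\ C 1 u = u &
      forall u1 u2 v1 v2, 0 <= u1 -> u1 <= u2 -> u2 <= 1 ->
        0 <= v1 -> v1 <= v2 -> v2 <= 1 ->
        0 <= C u2 v2 - C u1 v2 - C u2 v1 + C u1 v1].

Definition copula_bar C (u v : R) : R := u + v - 1 + C (1 - u) (1 - v).

Definition chi_at C (t : R) : R := t * copula_bar C (1 / t) (1 / t).

Definition chi_lim C : R := lim (chi_at C t @[t --> +oo]).

Definition copulas2 : set (R -> R -> R) :=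
  [set C | is_copula C /\ cvg (chi_at C t @[t --> +oo])].

Definition second_order_class (rho M : R) : set (R -> R -> R) :=
  [set C | copulas2 C /\
    forall t, 1 < t -> `|chi_at C t - chi_lim C| <= M * t `^ (- rho)].

(* Sklar's representation; for continuous margins it determines the copula C
   on the unit square. *)
Definition is_copula_of {disp : measure_display} {Omega : measurableType disp}
    {P : probability Omega R} (X Y : {RV P >-> R}) C : Prop :=
  is_copula C /\
  forall x y : R, P [set w | X w <= x /\ Y w <= y]
                  = (C (fine (cdf X x)) (fine (cdf Y y)))%:E.

End copulas.

Section parameters.
Context {R : realType} {d K : nat}.
Implicit Types A : 'M[R]_(d, K).

Definition pure_vars A (a : 'I_K) : {set 'I_d} :=
  [set j | (0 < A j a) && [forall b, (b != a) ==> (A j b == 0)]]%SET.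

Definition pure_set A : {set 'I_d} := (\bigcup_(a < K) pure_vars A a)%SET.

Definition in_Theta_L A : Prop :=
  [/\ (1 <= K <= d)%N,
      forall j a, 0 <= A j a,
      forall j, \sum_a A j a = 1 &
      forall a, pure_vars A a != finset.set0].

Definition stdf_of A (x : 'I_d -> R) : R :=
  \sum_(a < K) \big[Num.max/0]_(j < d) (A j a * x j).

Definition row_sparsity A : nat :=
  (\max_(j < d) #|[set a | (0 < A j a)%R]%SET|)%N.

(* When 0 <= A j a <= 1 all terms are at most 1/2, so the starting value 1/2
   only matters if there is no entry outside {0, 1}. *)
Definition signal_strength A : R :=
  \big[Num.min/2^-1]_(p : 'I_d * 'I_K | (A p.1 p.2 != 0) && (A p.1 p.2 != 1))
    Num.min (A p.1 p.2) (1 - A p.1 p.2).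

Definition norm_inf2 A : R :=
  \big[Num.max/0]_(j < d) Num.sqrt (\sum_(a < K) `|A j a| ^+ 2).

End parameters.

Definition loss_inf2 {R : realType} {d K K' : nat}
    (A : 'M[R]_(d, K)) (A' : 'M[R]_(d, K')) : \bar R :=
  if K' =P K is ReflectT e then
    \big[Order.min/+oo%E]_(s : 'S_K)
      (norm_inf2 (A - castmx (erefl d, e) A' *m perm_mx s))%:E
  else +oo%E.

Section ranks.
Context {R : realType}.

(* rk is a ranking 1..n of x_1, ..., x_n, with an arbitrary choice of the order
   among tied observations. *)
Definition is_ranking (n : nat) (x : 'I_n -> R) (rk : 'I_n -> nat) : Prop :=
  [/\ injective rk,
      forall i, (1 <= rk i <= n)%N &
      forall i i', x i < x i' -> (rk i < rk i')%N].

Definition chi_hat (n d k : nat) (rk : 'I_n -> 'I_d -> nat) (j l : 'I_d) : R :=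
  k%:R^-1 * \sum_(i < n) ((n - k < rk i j) && (n - k < rk i l))%N%:R.

End ranks.

Section algorithms.
Context {R : realType} {d : nat}.
Variable chi : 'I_d -> 'I_d -> R.

Definition edge (kappa : R) (j l : 'I_d) : bool :=
  (j != l) && (chi j l <= kappa).

Definition is_clique (kappa : R) (C : {set 'I_d}) : Prop :=
  forall j l, j \in C -> l \in C -> j != l -> edge kappa j l.

Definition is_max_clique (kappa : R) (C : {set 'I_d}) : Prop :=
  is_clique kappa C /\
  forall C' : {set 'I_d}, is_clique kappa C' -> (#|C'| <= #|C|)%N.

(* c enumerates the elements of a maximum clique without repetition; there may
   be several maximum cliques, so this is a relation and not a function. *)
Definition is_PureVar (kappa : R) (K : nat) (c : 'I_K -> 'I_d) : Prop :=
  injective c /\ is_max_clique kappa [set c a | a : 'I_K]%SET.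

Definition I_hat_part (kappa : R) (K : nat) (c : 'I_K -> 'I_d) (a : 'I_K) :
  {set 'I_d} := (c a |: [set l | 1 - kappa <= chi (c a) l])%SET.

Definition I_hat (kappa : R) (K : nat) (c : 'I_K -> 'I_d) : {set 'I_d} :=
  (\bigcup_(a < K) I_hat_part kappa c a)%SET.

(* With 0-based indices s`_b is the (b+1)-st largest component, so that
   simplex_rho is the largest b with w_(b) > (w_(1) + ... + w_(b) - 1) / b. *)
Definition simplex_rho (s : seq R) : nat :=
  (\max_(b < size s | (s`_b > (b.+1)%:R^-1 * (\sum_(a < b.+1) s`_a - 1))%R) b.+1)%N.

Definition simplex_tau (s : seq R) : R :=
  (simplex_rho s)%:R^-1 * (-1 + \sum_(b < simplex_rho s) s`_b).

Definition simplex_proj (T : finType) (w : T -> R) (t : T) : R :=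
  Num.max (w t - simplex_tau (sort >=%R [seq w u | u : T])) 0.

Definition sparse_proj (p : nat) (w : 'I_p -> R) (a : 'I_p) : R :=
  if insub a is Some u
  then simplex_proj (fun b : {b : 'I_p | 0 < w b} => w (val b)) u
  else 0.

Definition A_hat1 (kappa : R) (K : nat) (c : 'I_K -> 'I_d) (j : 'I_d)
    (a : 'I_K) : R :=
  #|I_hat_part kappa c a|%:R^-1 * \sum_(l in I_hat_part kappa c a) chi j l.

Definition A_hat2 (kappa kappabar : R) (K : nat) (c : 'I_K -> 'I_d) (j : 'I_d)
    (a : 'I_K) : R :=
  if kappabar < A_hat1 kappa c j a then A_hat1 kappa c j a else 0.

(* A row j is left unconstrained (apart from its entries being in [0, 1]) if j
   lies in several sets I_hat_part, or if j is outside I_hat and its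
   thresholded row vanishes. *)
Definition is_HTSP (kappa kappabar : R) (K : nat) (c : 'I_K -> 'I_d)
    (A : 'M[R]_(d, K)) : Prop :=
  [/\ forall j a, 0 <= A j a <= 1,
      forall j a, j \in I_hat_part kappa c a ->
        (forall b, j \in I_hat_part kappa c b -> b = a) ->
        forall b, A j b = (b == a)%:R &
      forall j, j \notin I_hat kappa c ->
        (exists a, A_hat2 kappa kappabar c j a != 0) ->
        forall a, A j a = sparse_proj (A_hat2 kappa kappabar c j) a].

End algorithms.

(* Main.v *)
(* On an event of probability at least 1 - n^-2 every empirical tail
   correlation is within kappa of the model value
     chi(j, l) = sum_a min(A_ja, A_la),
   and on that event the algorithms recover everything by a deterministic
   argument, so Borel-Cantelli concludes.

   Probability: the observations exceeding their (1 - k/n)-quantile and those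
   with the k largest ranks are both up-sets of the same order, hence nested, so
   replacing ranks by quantiles costs only the deviation of binomial counts from
   their means. A Chernoff bound for these counts and a union bound over all
   pairs leave the bias M (k/n)^r plus three deviations of order sqrt(L/k), where
   L = ln(4dn^2).

   Determinism: once 2 kappa is below the signal strength, two variables are
   joined by an edge exactly when their rows have disjoint supports. As there are
   only K factors, a maximum clique consists of one pure variable per factor. The
   thresholded row of a mixed variable has the correct support, and there the
   simplex projection subtracts the mean error, which is at most kappa. *)

Require Import Defs.
From HB Require Import structures.
From mathcomp Require Import all_boot all_order all_algebra all_fingroup.
From mathcomp Require Import all_classical all_reals all_analysis.
From mathcomp Require Import zify ring lra.

Set Implicit Arguments.
Unset Strict Implicit.
Unset Printing Implicit Defensive.

Import Order.TTheory GRing.Theory Num.Theory.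
Import numFieldNormedType.Exports.

Local Open Scope classical_set_scope.
Local Open Scope ring_scope.

(** * Simplex projection and exact recovery *)

Section simplex_projection.
Context {R : realType}.

(** When every entry survives the shift by the full mean, the index [size s] meets the condition in
    [simplex_rho], and no index is larger. *)
Lemma simplex_tauE (s : seq R) : (0 < size s)%N ->
  {in s, forall x, (\sum_(y <- s) y - 1) / (size s)%:R < x} ->
  simplex_tau s = (\sum_(y <- s) y - 1) / (size s)%:R.
Proof.
move=> s0 hs; have rhoE : simplex_rho s = size s.
  apply/eqP; rewrite eqn_leq; apply/andP; split.
    by apply/bigmax_leqP => b _; exact: ltn_ord.
  have ls : ((size s).-1 < size s)%N by rewrite prednK.
  rewrite -[leqLHS](prednK s0).
  (* The witness is the last 0-based index, whose contribution [b.+1] is [size s]; its condition is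
     the hypothesis at the last entry. *)
  apply: (@leq_bigmax_cond _ _ (fun b : 'I_(size s) => b.+1) (Ordinal ls)).
  rewrite /= prednK// mulrC.
  have /hs := mem_nth 0 ls; congr (_ < _); congr ((_ - 1) * _).
  by rewrite (big_nth 0) big_mkord.
rewrite /simplex_tau rhoE mulrC addrC; congr ((_ - 1) * _).
by rewrite (big_nth 0) big_mkord.
Qed.

Lemma simplex_projE (T : finType) (w : T -> R) (m := (\sum_u w u - 1) / #|T|%:R) :
  (0 < #|T|)%N -> (forall t, m < w t) ->
  forall t, simplex_proj w t = w t - m.
Proof.
move=> T0 wm t; rewrite /simplex_proj; set s := sort _ _.
have ps : perm_eq s [seq w u | u : T] by rewrite /s perm_sort perm_refl.
have sE : size s = #|T| by rewrite (perm_size ps) size_map cardE.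
have SE : \sum_(y <- s) y = \sum_u w u.
  by rewrite (perm_big _ ps)/= big_map big_enum.
rewrite simplex_tauE ?sE// ?SE; last first.
  move=> x; rewrite (perm_mem ps) => /mapP[u _ ->]; exact: wm.
by rewrite max_l// subr_ge0 ltW// wm.
Qed.

(** Closed form in the case where the projection clips nothing on the support: every positive
    coordinate is lowered by the same amount. *)
Lemma sparse_projE (p : nat) (w : 'I_p -> R) (S := [pred b | 0 < w b])
    (m := (\sum_(b in S) w b - 1) / #|S|%:R) :
  (0 < #|S|)%N -> (forall b, 0 < w b -> m < w b) ->
  forall a, sparse_proj w a = if 0 < w a then w a - m else 0.
Proof.
move=> S0 wm a; rewrite /sparse_proj; case: insubP => [u wa ua|/negbTE -> //].
rewrite wa simplex_projE; last 2 first.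
- by rewrite card_sig.
- move=> t; rewrite card_sig -(big_sub [pred b | 0 < w b]).
  by apply: wm; exact: (valP t).
by rewrite card_sig -(big_sub [pred b | 0 < w b]) ua.
Qed.

End simplex_projection.

(** * Deterministic recovery from uniformly close tail correlations *)

Definition tail_cor {R : realType} {d K : nat} (A : 'M[R]_(d, K)) (j l : 'I_d) : R :=
  \sum_a Num.min (A j a) (A l a).

Definition row_support {R : realType} {d K : nat} (A : 'M[R]_(d, K)) (j : 'I_d) :
  {set 'I_K} := [set a | 0 < A j a]%SET.

Section factor_model.
Context {R : realType} {d K : nat} (A : 'M[R]_(d, K)).
Hypothesis Theta : in_Theta_L A.

Lemma Theta_ge0 j a : 0 <= A j a. Proof. by case: Theta. Qed.

Lemma Theta_sum1 j : \sum_a A j a = 1. Proof. by case: Theta. Qed.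

Lemma Theta_le1 j a : A j a <= 1.
Proof.
rewrite -(Theta_sum1 j) (bigD1 a)//= lerDl.
by apply: sumr_ge0 => b _; exact: Theta_ge0.
Qed.

Lemma Theta_unit_row j a : A j a = 1 -> forall b, b != a -> A j b = 0.
Proof.
move=> ja; have := Theta_sum1 j; rewrite (bigD1 a)//= ja.
move=> /eqP; rewrite -subr_eq0 addrAC subrr add0r => /eqP s0 b ba.
by apply: (psumr_eq0P _ s0) => // ? _; exact: Theta_ge0.
Qed.

Lemma pure_varsP j a : reflect (A j a = 1) (j \in pure_vars A a).
Proof.
apply: (iffP idP) => [|ja].
  rewrite inE => /andP[_ /forallP h]; rewrite -(Theta_sum1 j).
  rewrite [RHS](bigD1 a)//= [X in _ = _ + X]big1 ?addr0// => b ba.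
  by have /implyP/(_ ba)/eqP := h b.
rewrite inE ja ltr01; apply/forallP => b; apply/implyP => ba.
by rewrite (Theta_unit_row ja).
Qed.

Lemma tail_corC j l : tail_cor A j l = tail_cor A l j.
Proof. by apply: eq_bigr => a _; rewrite minC. Qed.

Lemma tail_cor_diag j : tail_cor A j j = 1.
Proof. by rewrite -(Theta_sum1 j); apply: eq_bigr => a _; rewrite minxx. Qed.

Lemma tail_cor_pure j l a : A j a = 1 -> tail_cor A j l = A l a.
Proof.
move=> ja; rewrite /tail_cor (bigD1 a)//= ja min_r ?Theta_le1// big1 ?addr0// => b ba.
by rewrite (Theta_unit_row ja ba) min_l// Theta_ge0.
Qed.

Lemma row_support_neq0 j : (0 < #|row_support A j|)%N.
Proof.
rewrite lt0n cards_eq0; apply/eqP => s0.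
have /eqP := Theta_sum1 j; rewrite big1 ?(eq_sym 0) ?oner_eq0// => a _; apply/eqP.
move/setP/(_ a) : s0; rewrite !inE lt_neqAle Theta_ge0 andbT => /negbFE.
by rewrite eq_sym.
Qed.

Lemma row_support_eq1 j a : row_support A j = [set a]%SET -> A j a = 1.
Proof.
move=> sE; rewrite -(Theta_sum1 j) [RHS](bigD1 a)//= big1 ?addr0// => b ba.
apply/eqP; move/setP/(_ b): sE; rewrite !inE (negbTE ba) lt_neqAle Theta_ge0 andbT.
by move/negbFE; rewrite eq_sym.
Qed.

Lemma tail_cor_disjoint j l :
  [disjoint row_support A j & row_support A l]%B -> tail_cor A j l = 0.
Proof.
move=> dis; apply: big1 => a _; apply/eqP; rewrite eq_le le_min !Theta_ge0 !andbT.
rewrite leNgt lt_min; apply/negP => /andP[ja la].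
have : a \in row_support A l by rewrite inE.
by have /(disjointFr dis) -> : a \in row_support A j by rewrite inE.
Qed.

Variable eta : R.
Hypothesis eta_le : eta <= signal_strength A.

Lemma signal_le_half : eta <= 2^-1.
Proof. by apply: (le_trans eta_le); exact: bigmin_le_id. Qed.

(** Entries in (0,1) take part in the minimum defining the signal strength; an entry equal to 1 does
    not, and is handled by [eta <= 1/2]. *)
Lemma signal_entry j a : 0 < A j a -> eta <= A j a.
Proof.
move=> ja; have [->|ja1] := eqVneq (A j a) 1.
  by apply: (le_trans signal_le_half); lra.
apply: (le_trans eta_le); apply: (@le_trans _ _ (Num.min (A j a) (1 - A j a))).
  apply: (@bigmin_le_cond _ _ _ _ (j, a) _ (fun p => Num.min (A p.1 p.2) (1 - A p.1 p.2))).
  by rewrite /= gt_eqF.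
by rewrite ge_min lexx.
Qed.

Lemma signal_entry_compl j a : A j a != 1 -> A j a <= 1 - eta.
Proof.
move=> ja1; have [->|ja0] := eqVneq (A j a) 0; first by have := signal_le_half; lra.
suff : eta <= 1 - A j a by lra.
apply: (le_trans eta_le); apply: (@le_trans _ _ (Num.min (A j a) (1 - A j a))).
  apply: (@bigmin_le_cond _ _ _ _ (j, a) _ (fun p => Num.min (A p.1 p.2) (1 - A p.1 p.2))).
  by rewrite /= ja0.
by rewrite ge_min lexx orbT.
Qed.

Lemma tail_cor_meet j l :
  ~~ [disjoint row_support A j & row_support A l]%B -> eta <= tail_cor A j l.
Proof.
move=> /pred0Pn[a /andP[/= ]]; rewrite !inE => ja la.
rewrite /tail_cor (bigD1 a)//= -[eta]addr0 lerD//.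
  by rewrite le_min !signal_entry.
by apply: sumr_ge0 => b _; rewrite le_min !Theta_ge0.
Qed.

Variables (chi : 'I_d -> 'I_d -> R) (kap : R).
Hypotheses (kap_lt : 2 * kap < eta)
  (chi_close : forall j l, `|chi j l - tail_cor A j l| <= kap).

(** Disjoint supports make [tail_cor] vanish, so [chi <= kap]; a shared factor makes it at least
    [eta > 2 * kap], so [chi > kap]. *)
Lemma edgeE j l : edge chi kap j l =
  (j != l) && [disjoint row_support A j & row_support A l]%B.
Proof.
rewrite /edge; congr andb; have := chi_close j l.
have [dis|ndis] := boolP [disjoint row_support A j & row_support A l]%B.
  by rewrite tail_cor_disjoint// subr0 => /(le_trans (ler_norm _)).
have := tail_cor_meet ndis; rewrite ler_norml => ? /andP[? _]; apply/negP => ?.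
by have := kap_lt; lra.
Qed.

Variables (Kh : nat) (c : 'I_Kh -> 'I_d).
Hypothesis PureVar_c : is_PureVar chi kap c.

(** One pure variable per factor forms a clique, so [K <= Kh] by maximality. The supports of the
    clique rows are non-empty and disjoint inside K factors, so they are singletons and there are
    exactly K of them. *)
Lemma is_PureVar_factors : exists2 s : 'I_Kh -> 'I_K,
  bijective s & forall a, A (c a) (s a) = 1.
Proof.
case: PureVar_c => cinj [cliq cmax].
have cdis a a' : a != a' ->
    [disjoint row_support A (c a) & row_support A (c a')]%B.
  move=> aa'; have : edge chi kap (c a) (c a').
    by apply: cliq; rewrite ?imset_f//; apply: contra aa' => /eqP/cinj ->.
  by rewrite edgeE => /andP[].
have KKh : (K <= Kh)%N.
  have pv a : exists j, A j a == 1.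
    by case: Theta => _ _ _ /(_ a)/set0Pn[j /pure_varsP jE]; exists j; rewrite jE.
  pose p a := xchoose (pv a); have pE a : A (p a) a = 1.
    by have /eqP := xchooseP (pv a).
  have pinj : injective p.
    move=> a b ab; apply/eqP; apply: contraT => nab.
    have := Theta_unit_row (pE a); move=> /(_ b); rewrite eq_sym nab ab pE.
    by move=> /(_ isT)/eqP; rewrite oner_eq0.
  have -> : K = #|[set p a | a : 'I_K]%SET| by rewrite card_imset// card_ord.
  have -> : Kh = #|[set c a | a : 'I_Kh]%SET| by rewrite card_imset// card_ord.
  apply: cmax => _ _ /imsetP[a _ ->] /imsetP[b _ ->] pab.
  rewrite edgeE pab /=; apply/pred0P => e; apply/negP => /andP[]/=; rewrite !inE.
  have {}pab : a != b by apply: contra pab => /eqP ->.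
  have [->|ea] := eqVneq e a; last by rewrite (Theta_unit_row (pE a) ea) ltxx.
  by rewrite (Theta_unit_row (pE b) pab) ltxx.
(* Double counting: after exchanging the sums, each factor is counted at most once because the
   supports are disjoint. *)
have sumK : (\sum_(a < Kh) #|row_support A (c a)| <= K)%N.
  under eq_bigr do rewrite -sum1_card big_mkcond.
  rewrite exchange_big /= -[leqRHS]card_ord -[leqRHS]sum1_card leq_sum// => b _.
  rewrite -big_mkcond sum1_card; apply/card_le1_eqP => a a'.
  rewrite ![_ \in _]unfold_in => ba ba'; apply/eqP; rewrite eq_sym; apply: contraT => /cdis dis.
  by have := disjointFr dis ba; rewrite [_ \in _]ba'.
(* A support with two elements, the others having at least one, would push the sum above [Kh] and
   give [Kh < K]. *)
have card1 a : #|row_support A (c a)| = 1%N.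
  apply/eqP; rewrite eqn_leq row_support_neq0 andbT leqNgt; apply/negP => ca.
  have : (Kh < K)%N; last by rewrite ltnNge KKh.
  apply: leq_trans sumK; rewrite (bigD1 a)//= -[in ltnLHS](card_ord Kh).
  rewrite -[in ltnLHS]sum1_card (bigD1 a)//= -addSn leq_add// leq_sum// => b _.
  exact: row_support_neq0.
have sP a : exists b, A (c a) b == 1.
  have /eqP/cards1P[b bE] := card1 a; exists b; apply/eqP.
  exact: row_support_eq1.
pose s a := xchoose (sP a); have sE a : A (c a) (s a) = 1.
  by have /eqP := xchooseP (sP a).
exists s => //; apply: inj_card_bij; last by rewrite !card_ord.
move=> a a' ss; apply/eqP; apply: contraT => /cdis dis.
have := @disjointFr _ _ _ (s a) dis; rewrite !inE {2}ss !sE ltr01.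
by move=> /(_ isT).
Qed.

Variable s : 'I_Kh -> 'I_K.
Hypotheses (sbij : bijective s) (sE : forall a, A (c a) (s a) = 1).

(** Since [c a] is pure, [chi (c a) l] is within [kap] of [A l (s a)]. This entry is either 1 or at
    most [1 - eta < 1 - 2 * kap], so the cut at [1 - kap] separates the two cases. *)
Lemma I_hat_partE a : I_hat_part chi kap c a = pure_vars A (s a).
Proof.
apply/setP => l; apply/idP/pure_varsP; rewrite !inE.
  move=> /orP[/eqP -> //|ll]; apply/eqP; apply: contraT => /signal_entry_compl.
  have := chi_close (c a) l; rewrite (tail_cor_pure _ (sE a)) ler_norml.
  by move=> /andP[_] *; have := kap_lt; lra.
move=> ls; apply/orP; right; have := chi_close (c a) l.
by rewrite (tail_cor_pure _ (sE a)) ls ler_norml => /andP[? _]; lra.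
Qed.

Lemma I_hatE : I_hat chi kap c = pure_set A.
Proof.
rewrite /I_hat /pure_set; under eq_bigr do rewrite I_hat_partE.
by rewrite [RHS](reindex s)//; exact: onW_bij.
Qed.

(** Every pure variable l of factor [s a] has the same model value [tail_cor A j l = A j (s a)], and
    averaging does not increase the error. *)
Lemma A_hat1_close j a : `|A_hat1 chi kap c j a - A j (s a)| <= kap.
Proof.
rewrite /A_hat1 I_hat_partE; set I := pure_vars _ _.
have I0 : (0 < #|I|)%N by rewrite lt0n cards_eq0; case: Theta => _ _ _ /(_ (s a)).
have -> : A j (s a) = #|I|%:R^-1 * \sum_(l in I) tail_cor A j l.
  rewrite (eq_bigr (fun=> A j (s a))) => [|l /pure_varsP ls].
    by rewrite sumr_const -[A j _ *+ _]mulr_natl mulKf// pnatr_eq0 -lt0n.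
  by rewrite tail_corC (tail_cor_pure _ ls).
rewrite -mulrBr -sumrB normrM ger0_norm ?invr_ge0// ler_pdivrMl ?ltr0n//.
rewrite mulr_natl -sumr_const (le_trans (ler_norm_sum _ _ _))//.
by apply: ler_sum => l _.
Qed.

(** A zero entry is estimated by at most [kap] and removed by the strict threshold; a positive one
    is at least [eta > 2 * kap], so its estimate exceeds [kap]. *)
Lemma A_hat2_supp j a : (0 < A_hat2 chi kap kap c j a) = (0 < A j (s a)).
Proof.
have := A_hat1_close j a; rewrite /A_hat2 ler_norml => /andP[h1 h2].
have kap0 : 0 <= kap by lra.
case: ifPn => [h|]; last first.
  rewrite -leNgt ltxx => h; apply/esym/negP => /signal_entry.
  by have := kap_lt; lra.
rewrite (le_lt_trans kap0 h); apply/esym; rewrite lt0r Theta_ge0 andbT.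
by apply/eqP => A0; move: h2; rewrite A0; lra.
Qed.

Lemma A_hat2_close j a : `|A_hat2 chi kap kap c j a - A j (s a)| <= kap.
Proof.
have := A_hat2_supp j a; have := A_hat1_close j a; rewrite /A_hat2.
case: ifPn => [//|_ h]; rewrite ltxx => /esym/negbT; rewrite -leNgt => h2.
have -> : A j (s a) = 0 by apply/eqP; rewrite eq_le h2 Theta_ge0.
by rewrite subrr normr0 (le_trans (normr_ge0 _) h).
Qed.

Variable Ah : 'M[R]_(d, Kh).
Hypothesis HTSP_Ah : is_HTSP chi kap kap c Ah.

(** The sets [I_hat_part] are the disjoint sets of pure variables, so j lies in exactly one of them
    and [is_HTSP] determines its row. *)
Lemma is_HTSP_pure j b : j \in pure_vars A b -> forall a, Ah j a = A j (s a).
Proof.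
case: HTSP_Ah => _ hI _; case: sbij => t ts st jb a.
have jtb : j \in I_hat_part chi kap c (t b) by rewrite I_hat_partE st.
rewrite (hI j (t b))//; last first.
  move=> e; rewrite I_hat_partE => /pure_varsP je; apply/eqP; apply: contraT => eb.
  have : s e != b by apply: contra eb => /eqP <-; rewrite ts.
  move=> /(Theta_unit_row (pure_varsP _ _ jb)); rewrite je => /eqP.
  by rewrite oner_eq0.
move/pure_varsP : jb => jb.
have [->|ab] := eqVneq a (t b); first by rewrite st jb.
rewrite (Theta_unit_row jb)//; apply: contra ab => /eqP <-.
by rewrite ts.
Qed.

(** The true entries on the recovered support sum to 1, so the amount subtracted by the projection
    is the average of the errors of [A_hat2] there. *)
Lemma is_HTSP_mixed j : j \notin pure_set A ->
  exists2 m : R, `|m| <= kap &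
    forall a, Ah j a = if 0 < A j (s a) then A_hat2 chi kap kap c j a - m else 0.
Proof.
move=> jI; case: HTSP_Ah => _ _ /(_ j); rewrite I_hatE => /(_ jI).
have ws := A_hat2_supp j; have wc := A_hat2_close j.
move: (A_hat2 chi kap kap c j) ws wc => w ws wc hJ.
have [a0 wa0] : exists a, 0 < w a.
  have := row_support_neq0 j; rewrite card_gt0 => /set0Pn[b]; rewrite inE => jb.
  by case: sbij => t ts st; exists (t b); rewrite ws st.
have {}hJ := hJ (ex_intro _ a0 (lt0r_neq0 wa0)).
pose S := [pred b | 0 < w b].
have S0 : (0 < #|S|)%N by apply/card_gt0P; exists a0.
have sumS : \sum_(b in S) A j (s b) = 1.
  rewrite big_mkcond /= -(Theta_sum1 j).
  rewrite [RHS](reindex s) /=; last exact: onW_bij.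
  apply: eq_bigr => b _; case: ifPn => //; rewrite inE /= ws -leNgt => h.
  by apply/eqP; rewrite eq_le h Theta_ge0.
pose m := (\sum_(b in S) w b - 1) / #|S|%:R.
have mk : `|m| <= kap.
  rewrite /m -[X in _ - X]sumS -sumrB normrM normfV ler_pdivrMr ?normr_gt0 ?pnatr_eq0 -?lt0n//.
  rewrite normr_nat mulrC mulr_natl -sumr_const.
  rewrite (le_trans (ler_norm_sum _ _ _))//.
  by apply: ler_sum => l _; exact: wc.
exists m => // a; rewrite hJ sparse_projE//; first by rewrite ws.
(* Nothing is clipped: [w b >= eta - kap > kap >= m]. *)
move=> b; rewrite ws => /signal_entry sb.
have := wc b; move: mk; rewrite !ler_norml -/S -/m.
by have := kap_lt; lra.
Qed.

(** One [kap] comes from [A_hat2] and one from the subtracted mean; positivity survives because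
    [2 * kap < eta]. *)
Lemma is_HTSP_entry j a :
  (0 < Ah j a) = (0 < A j (s a)) /\ `|Ah j a - A j (s a)| <= 2 * kap.
Proof.
have kap0 : 0 <= kap by apply: le_trans (chi_close j j).
have [|/is_HTSP_mixed[m mk ->]] := boolP (j \in pure_set A).
  move=> /bigcupP[b _ /is_HTSP_pure ->]; split => //.
  by rewrite subrr normr0 mulr_ge0.
have := A_hat2_close j a; move: mk; rewrite !ler_norml => mk wk.
case: ifPn => [/signal_entry h|].
  by split; [have := kap_lt; lra|lra].
rewrite -leNgt ltxx => h; split => //.
have -> : A j (s a) = 0 by apply/eqP; rewrite eq_le h Theta_ge0.
lra.
Qed.

Lemma is_HTSP_row_sparsity : row_sparsity Ah = row_sparsity A.
Proof.
apply: eq_bigr => j _; rewrite -(@on_card_preimset _ _ s [set a | 0 < A j a]%SET).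
  by apply: eq_card => a; rewrite !inE (is_HTSP_entry j a).1.
exact: onW_bij.
Qed.

(** Equal supports leave at most [row_sparsity A] non-zero errors in a row, each at most
    [2 * kap]. *)
Lemma is_HTSP_norm :
  norm_inf2 (Ah - \matrix_(j, a) A j (s a)) <= 2 * kap * Num.sqrt (row_sparsity A)%:R.
Proof.
(* Since [1 <= K <= d] there is an index [j0], and closeness at [j0] forces [0 <= kap]. *)
apply/bigmax_leP; have [j0|nd] := pickP (fun _ : 'I_d => true); last first.
  case: Theta => /andP[K1 Kd] _ _ _.
  have d0 := leq_trans K1 Kd; by have := nd (Ordinal d0).
have kap0 : 0 <= kap by apply: le_trans (chi_close j0 j0).
split=> [|j _]; first by rewrite !mulr_ge0.
have -> : 2 * kap = Num.sqrt ((2 * kap) ^+ 2) by rewrite sqrtr_sqr ger0_norm ?mulr_ge0.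
rewrite -sqrtrM ?sqr_ge0// ler_wsqrtr//.
have jr : (#|row_support Ah j| <= row_sparsity A)%N.
  by rewrite -is_HTSP_row_sparsity; exact: (leq_bigmax j).
apply: (@le_trans _ _ ((2 * kap) ^+ 2 * #|row_support Ah j|%:R)); last first.
  by rewrite ler_wpM2l ?sqr_ge0// ler_nat.
rewrite mulr_natr -sumr_const [leRHS]big_mkcond; apply: ler_sum => a _.
rewrite !mxE inE; have [sup ent] := is_HTSP_entry j a.
rewrite sup; case: ifPn => [_|]; first by rewrite lerXn2r ?nnegrE// mulr_ge0.
move=> h; have A0 : A j (s a) = 0 by apply/eqP; rewrite eq_le Theta_ge0 leNgt h.
have -> : Ah j a = 0.
  by apply/eqP; rewrite eq_le leNgt sup h; case: HTSP_Ah => /(_ j a)/andP[].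
by rewrite A0 subrr normr0 expr0n.
Qed.

End factor_model.

Lemma HTSP_exact_recovery {R : realType} {d K Kh : nat} (A : 'M[R]_(d, K))
    (Ah : 'M[R]_(d, Kh)) (chi : 'I_d -> 'I_d -> R) (c : 'I_Kh -> 'I_d) (eta kap : R) :
  in_Theta_L A -> eta <= signal_strength A -> 2 * kap < eta ->
  (forall j l, `|chi j l - tail_cor A j l| <= kap) ->
  is_PureVar chi kap c -> is_HTSP chi kap kap c Ah ->
  [/\ I_hat chi kap c = pure_set A, Kh = K, row_sparsity Ah = row_sparsity A &
      (loss_inf2 Ah A <= (2 * kap * Num.sqrt (row_sparsity A)%:R)%:E)%E].
Proof.
move=> Th He Hk Hc HP HA.
have [s sbij sE] := is_PureVar_factors Th He Hk Hc HP.
have KhK : Kh = K by have := bij_eq_card sbij; rewrite !card_ord.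
split=> //.
- exact: (I_hatE Th He Hk Hc sbij sE).
- exact: (is_HTSP_row_sparsity Th He Hk Hc sbij sE HA).
have := is_HTSP_norm Th He Hk Hc sbij sE HA.
subst Kh; rewrite /loss_inf2; case: eqP => // e; rewrite (eq_axiomK e) castmx_id.
have sinj := bij_inj sbij.
(* The inverse permutation appears because permuting columns by [s] is right multiplication by the
   matrix of its inverse. *)
move=> le; apply: (@le_trans _ _ (norm_inf2 (Ah - A *m perm_mx (perm sinj)^-1))%:E).
  exact: bigmin_le.
rewrite lee_fin (le_trans _ le)// le_eqVlt; apply/orP; left; apply/eqP; congr (norm_inf2 (_ - _)).
apply/matrixP => j a; rewrite -col_permE !mxE.
by rewrite permE.
Qed.

(** * Ranks *)

Section ranks.
Context {R : realType}.

(** The ranks shifted down by one form a bijection of ['I_n], under which the complement becomes the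
    first [n - k] indices. *)
Lemma card_top_ranks (n k : nat) (rk : 'I_n -> nat) : (k <= n)%N -> injective rk ->
  (forall i, (1 <= rk i <= n)%N) -> #|[set i | (n - k < rk i)%N]%SET| = k.
Proof.
move=> kn rinj rb; case: n => [|n] in kn rk rinj rb *.
  by move: kn; rewrite leqn0 => /eqP->; apply: eq_card0 => -[].
pose f i : 'I_n.+1 := inord (rk i).-1.
have fE i : (f i).+1 = rk i :> nat.
  by have /andP[r1 rn] := rb i; rewrite inordK prednK.
have fbij : bijective f.
  apply: inj_card_bij => // i i' /(congr1 (fun m : 'I__ => m.+1)).
  by rewrite !fE => /rinj.
rewrite (eq_card (B := f @^-1: [set m : 'I_n.+1 | (n.+1 - k <= m)%N]%SET)); last first.
  by move=> i; rewrite !inE -fE ltnS.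
rewrite on_card_preimset; last exact: onW_bij.
have : #|~: [set m : 'I_n.+1 | (n.+1 - k <= m)%N]%SET| = (n.+1 - k)%N.
  rewrite (eq_card (B := [pred m : 'I_n.+1 | (m < n.+1 - k)%N])); last first.
    by move=> m; rewrite !inE ltnNge.
  by rewrite -sum1_card -(big_ord_widen n.+1 (fun=> 1%N)) ?leq_subr// sum1_card card_ord.
by have := cardsC [set m : 'I_n.+1 | (n.+1 - k <= m)%N]%SET; rewrite card_ord; lia.
Qed.

Lemma natr_card (T : finType) (B : {set T}) : #|B|%:R = \sum_i (i \in B)%:R :> R.
Proof.
by rewrite -sum1_card natr_sum big_mkcond; apply: eq_bigr => i _; case: (i \in B).
Qed.

(* Two up-sets of a total order are nested, so their symmetric difference has
   the size of the difference of their cardinalities. *)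
Lemma top_ranks_upset (n k : nat) (rk : 'I_n -> nat) (B : {set 'I_n}) :
  (k <= n)%N -> injective rk -> (forall i, (1 <= rk i <= n)%N) ->
  (forall i i', (rk i < rk i')%N -> i \in B -> i' \in B) ->
  \sum_i `|(n - k < rk i)%N%:R - (i \in B)%:R| = `|#|B|%:R - k%:R| :> R.
Proof.
move=> kn rinj rb Bup; have := card_top_ranks kn rinj rb.
set T := [set i | _]%SET => cT.
have -> : #|B|%:R - k%:R = \sum_i ((i \in B)%:R - (i \in T)%:R) :> R.
  by rewrite -cT !natr_card sumrB.
(* If some i in B is outside T, every element of T has a larger rank than i and so belongs to B. In
   either case all summands have the same sign. *)
have [BT|/subsetPn[i iB iT]] := boolP (B \subset T).
  rewrite -normrN -sumrN ger0_norm; last first.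
    apply: sumr_ge0 => i _; rewrite opprB subr_ge0 ler_nat.
    by case: (boolP (i \in B)) => // /(fintype.subsetP BT) ->.
  apply: eq_bigr => i _; rewrite opprB ger0_norm; first by rewrite inE.
  have -> : (n - k < rk i)%N = (i \in T) by rewrite inE.
  by rewrite subr_ge0 ler_nat; case: (boolP (i \in B)) => // /(fintype.subsetP BT) ->.
have TB i' : i' \in T -> i' \in B.
  move: iT; rewrite !inE -leqNgt => iT iT'.
  by apply: Bup iB; exact: leq_ltn_trans iT iT'.
rewrite ger0_norm; last first.
  apply: sumr_ge0 => i' _; rewrite subr_ge0 ler_nat.
  by case: (boolP (i' \in T)) => // /TB ->.
apply: eq_bigr => i' _; rewrite distrC ger0_norm; first by rewrite inE.
have -> : (n - k < rk i')%N = (i' \in T) by rewrite inE.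
by rewrite subr_ge0 ler_nat; case: (boolP (i' \in T)) => // /TB ->.
Qed.

Lemma norm_andb_le (a b c d : bool) :
  `|(a && b)%:R - (c && d)%:R| <= `|a%:R - c%:R| + `|b%:R - d%:R| :> R.
Proof.
by case: a; case: b; case: c; case: d => /=;
  rewrite ?(subrr, subr0, sub0r, normr0) ?normrN ?normr1; lra.
Qed.

(** Replaces the top-rank sets by sets that are upward closed in the observed values; each margin
    costs one symmetric difference, computed by [top_ranks_upset]. *)
Lemma chi_hat_upset (n d k : nat) (rk : 'I_n -> 'I_d -> nat) (x : 'I_n -> 'I_d -> R)
    (B : 'I_d -> {set 'I_n}) (j l : 'I_d) :
  (k <= n)%N -> (forall j, is_ranking (x ^~ j) (rk ^~ j)) ->
  (forall j i i', x i j <= x i' j -> i \in B j -> i' \in B j) ->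
  `|chi_hat k rk j l - k%:R^-1 * #|(B j :&: B l)%SET|%:R| <=
    k%:R^-1 * (`|#|B j|%:R - k%:R| + `|#|B l|%:R - k%:R|) :> R.
Proof.
move=> kn rkP Bup.
have rinj m : injective (rk ^~ m) by case: (rkP m).
have rb m i : (1 <= rk i m <= n)%N by case: (rkP m).
(* A smaller rank forces a value that is not larger, however ties are broken, so closure in the
   values gives closure in the ranks. *)
have Bup' m i i' : (rk i m < rk i' m)%N -> i \in B m -> i' \in B m.
  move=> ii'; apply: Bup; rewrite leNgt; apply/negP.
  by case: (rkP m) => _ _ /[apply]; rewrite ltnNge ltnW.
rewrite -!(top_ranks_upset kn (rinj _) (rb _) (Bup' _)) /chi_hat -mulrBr normrM.
rewrite ger0_norm ?invr_ge0// ler_wpM2l ?invr_ge0// -big_split /=.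
rewrite natr_card -sumrB /=.
rewrite (le_trans (ler_norm_sum _ _ _))//; apply: ler_sum => i _.
by rewrite finset.in_setI; exact: norm_andb_le.
Qed.

Lemma chi_hat_diag (n d k : nat) (rk : 'I_n -> 'I_d -> nat) (x : 'I_n -> R) (j : 'I_d) :
  (1 <= k <= n)%N -> is_ranking x (rk ^~ j) -> chi_hat k rk j j = 1 :> R.
Proof.
move=> /andP[k0 kn] [rinj rb _]; rewrite /chi_hat.
under eq_bigr do rewrite andbb.
rewrite -natr_sum -[RHS](@mulVf _ (k%:R : R)) ?pnatr_eq0 -?lt0n//.
rewrite -[X in _ = _ * X%:R](card_top_ranks kn rinj rb) natr_card natr_sum.
by congr (_ * _); apply: eq_bigr => i _; rewrite inE.
Qed.

End ranks.

(** * Chernoff bound *)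

Section chernoff.
Context {R : realType}.

Lemma expR_le_quadratic (x : R) : x <= 4^-1 -> expR x <= 1 + x + x ^+ 2.
Proof.
move=> x4.
(* squaring [expR (x/2) <= 1/(1-x/2)] gains a second order term *)
have e0 : 0 < 1 - x / 2 by lra.
have h : expR (x / 2) <= (1 - x / 2)^-1.
  rewrite -[leLHS]invrK lef_pV2 ?posrE ?invr_gt0 ?expR_gt0// -expRN.
  by apply: le_trans (expR_ge1Dx _).
have -> : x = x / 2 + x / 2 by lra.
rewrite expRD; apply: (@le_trans _ _ ((1 - x / 2)^-1 * (1 - x / 2)^-1)).
  by rewrite ler_pM ?expR_ge0.
rewrite -invfM -[leLHS]mul1r ler_pdivrMr ?mulr_gt0// mulrC.
have -> : x / 2 + x / 2 = x by lra.
(* The bound [x <= 1/4] makes [1 - 3 * x + x ^+ 2] positive. *)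
have -> : (1 - x / 2) * (1 - x / 2) * (1 + x + x ^+ 2) =
  1 + x ^+ 2 / 4 * (1 - 3 * x + x ^+ 2) by field.
rewrite lerDl mulr_ge0 ?divr_ge0 ?sqr_ge0//.
by have := sqr_ge0 x; lra.
Qed.

Variables (n : nat) (q : R).
Hypothesis q01 : 0 <= q <= 1.

(** The probability of the success pattern [s] in n independent Bernoulli trials with parameter q.
    It keeps the Chernoff argument a computation with finite sums. *)
Definition pattern_weight (s : {ffun 'I_n -> bool}) : R :=
  \prod_i (if s i then q else 1 - q).

Lemma pattern_weight_ge0 s : 0 <= pattern_weight s.
Proof. by case/andP: q01 => q0 q1; apply: prodr_ge0 => i _; case: ifP; lra. Qed.

(** The sum factorizes over the trials. One trial gives [1 - q + q * expR th <= expR (q * (th + th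
    ^+ 2))], and centring cancels the linear term. *)
Lemma pattern_mgf (th : R) : `|th| <= 4^-1 ->
  \sum_s pattern_weight s * expR (th * (\sum_i (s i)%:R - n%:R * q)) <=
    expR (th ^+ 2 * (n%:R * q)).
Proof.
case/andP: q01 => q0 q1 th4; pose F (b : bool) := (if b then q else 1 - q) * expR (th * (b%:R - q)).
have -> : \sum_s pattern_weight s * expR (th * (\sum_i (s i)%:R - n%:R * q)) =
    (\sum_(b : bool) F b) ^+ n.
  transitivity (\prod_(i < n) \sum_(b : bool) F b); last by rewrite prodr_const card_ord.
  rewrite bigA_distr_bigA; apply: eq_bigr => s _; rewrite big_split /=; congr (_ * _).
  rewrite -expR_sum -mulr_sumr sumrB; congr (expR (_ * (_ - _))).
  by rewrite sumr_const card_ord mulr_natl.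
rewrite mulrCA expRM_natl lerXn2r ?nnegrE ?expR_ge0//.
  by rewrite sumr_ge0// => -[] _; rewrite /F mulr_ge0 ?expR_ge0//=; lra.
rewrite big_bool /F /= mulrBr mulrBr !mulr0 sub0r mulr1 expRD.
have eth : expR th <= 1 + th + th ^+ 2.
  by apply: expR_le_quadratic; apply: le_trans th4; exact: ler_norm.
rewrite mulrA -mulrDl; apply: (@le_trans _ _ (expR (q * (th + th ^+ 2)) * expR (- (th * q)))).
  rewrite ler_wpM2r ?expR_ge0//; apply: le_trans (expR_ge1Dx _).
  have : q * expR th <= q * (1 + th + th ^+ 2) by rewrite ler_wpM2l//; lra.
  by lra.
by rewrite -expRD ler_expR; lra.
Qed.

(** Two-sided exponential Markov inequality: where [t <= |D|], D being the centred count, one of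
    [expR (th * (D - t))] and [expR (th * (- D - t))] is at least 1. *)
Lemma pattern_tail (k t : R) : n%:R * q <= k -> 0 < k -> 0 <= t <= k / 2 ->
  \sum_(s : {ffun 'I_n -> bool} | t <= `|\sum_i (s i)%:R - n%:R * q|)
    pattern_weight s <= 2 * expR (- (t ^+ 2 / (4 * k))).
Proof.
(* This [th] minimizes [- th * t + th ^+ 2 * k], with minimum [- t ^+ 2 / (4 * k)]; [t <= k / 2]
   keeps it below 1/4. *)
move=> nqk k0 /andP[t0 tk]; pose th := t / (2 * k).
have th0 : 0 <= th by rewrite divr_ge0//; lra.
have th4 : `|th| <= 4^-1 by rewrite ger0_norm// ler_pdivrMr; lra.
have thq : - (th * t) + th ^+ 2 * (n%:R * q) <= - (t ^+ 2 / (4 * k)).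
  apply: (@le_trans _ _ (- (th * t) + th ^+ 2 * k)).
    by rewrite lerD2l ler_wpM2l// sqr_ge0.
  by rewrite /th le_eqVlt; apply/orP; left; apply/eqP; field; rewrite gt_eqF.
have bnd (e : R) : `|e| <= 4^-1 -> e ^+ 2 = th ^+ 2 ->
    expR (- (th * t)) * \sum_s pattern_weight s * expR (e * (\sum_i (s i)%:R - n%:R * q))
    <= expR (- (t ^+ 2 / (4 * k))).
  move=> e4 ee; apply: (@le_trans _ _ (expR (- (th * t)) * expR (e ^+ 2 * (n%:R * q)))).
    by rewrite ler_wpM2l ?expR_ge0// pattern_mgf.
  by rewrite ee -expRD ler_expR.
have h1 := bnd th th4 erefl; have h2 := bnd (- th); rewrite normrN sqrrN in h2.
have {h2} h2 := h2 th4 erefl.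
apply: (@le_trans _ _ (expR (- (t ^+ 2 / (4 * k))) + expR (- (t ^+ 2 / (4 * k))))); last lra.
apply: le_trans (lerD h1 h2); rewrite -mulrDr -big_split /= mulr_sumr.
rewrite [leLHS]big_mkcond; apply: ler_sum => s _; set D := \sum_i _ - _.
rewrite -mulrDr mulrCA; have w0 := pattern_weight_ge0 s.
case: ifPn => [tD|_]; last by rewrite mulr_ge0// mulr_ge0 ?addr_ge0 ?expR_ge0.
rewrite ler_peMr// mulrDr -!expRD.
have [D0|D0] := leP 0 D.
- rewrite ger0_norm// in tD; rewrite -[leLHS]addr0 lerD ?expR_ge0// -expR0 ler_expR.
  by rewrite addrC -mulrBr mulr_ge0// subr_ge0.
- rewrite ltr0_norm// in tD; rewrite -[leLHS]add0r lerD ?expR_ge0// -expR0 ler_expR.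
  by rewrite addrC mulNr -mulrN -mulrBr mulr_ge0// subr_ge0.
Qed.

End chernoff.

(** * Deviation of counts in an i.i.d. sample *)

Section sample_tail.
Context {disp : measure_display} {Omega : measurableType disp} {R : realType}
  (P : probability Omega R).

Lemma measurable_bigcup_fin (T : finType) (C : pred T) (E : T -> set Omega) :
  (forall s, measurable (E s)) -> measurable (\bigcup_(s in [set` C]) E s).
Proof. by move=> mE; apply: fin_bigcup_measurable. Qed.

Lemma probability_bigcup_fin (T : finType) (C : pred T) (E : T -> set Omega) :
  (forall s, measurable (E s)) ->
  (P (\bigcup_(s in [set` C]) E s) <= \sum_(s | C s) P (E s))%E.
Proof.
move=> mE; rewrite bigcup_pred.
(* The induction also carries measurability of the partial union, which subadditivity requires. *)
apply: (@proj2 (measurable (\big[setU/set0]_(s in C) E s))).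
elim/big_rec2: _ => [|s x X _ [mX Xx]]; first by rewrite measure0.
split; first exact: measurableU.
by apply: le_trans (measureU2 _ _ _) _ => //; rewrite leeD2l.
Qed.

Lemma measurable_rvec (d : nat) (X : 'I_d -> {RV P >-> R}) :
  measurable_fun [set: Omega] (rvec X).
Proof.
apply/measurable_fun_tnthP => j.
rewrite (_ : _ \o _ = X j); last by apply/funext => w /=; rewrite tnth_mktuple.
have mX : measurable_fun [set: Omega] (X j) by exact: measurable_funP.
by move=> mT S mS; exact: (mX mT S mS).
Qed.

Lemma measurable_rvec_preimage (d : nat) (X : 'I_d -> {RV P >-> R})
    (S : set (d.-tuple (measurableTypeR R))) :
  measurable S -> measurable (rvec X @^-1` S).
Proof. by move=> mS; rewrite -[_ @^-1` _]setTI; exact: measurable_rvec. Qed.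

Variables (n d : nat) (X : 'I_d -> {RV P >-> R}) (Y : 'I_n -> 'I_d -> {RV P >-> R}).
Hypothesis XY : iid_sample X Y.
Variable B : set (d.-tuple (measurableTypeR R)).
Hypothesis mB : measurable B.

Definition sample_in (w : Omega) : {set 'I_n} := [set i | `[< B (rvec (Y i) w) >]]%SET.

Definition sample_pattern (s : {ffun 'I_n -> bool}) : set Omega :=
  [set w | forall i, (if s i then B else ~` B) (rvec (Y i) w)].

Lemma measurable_sample_pattern s : measurable (sample_pattern s).
Proof.
rewrite (_ : sample_pattern s =
    \bigcap_(i in [set: 'I_n]) (rvec (Y i) @^-1` (if s i then B else ~` B))).
  apply: fin_bigcap_measurable => // i _.
  by apply: measurable_rvec_preimage; case: ifP => // _; exact: measurableC.
by apply/seteqP; split => w /= h i; [move=> _|]; exact: h.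
Qed.

(** Reduces an event on the set of hits to a finite union of patterns, which yields both
    measurability and a union bound. *)
Lemma sample_in_eventE (Q : pred {set 'I_n}) :
  [set w | Q (sample_in w)] =
  \bigcup_(s in [set` [pred s : {ffun 'I_n -> bool} | Q [set i | s i]%SET]]) sample_pattern s.
Proof.
apply/seteqP; split => w /=.
  move=> Qw; exists [ffun i => `[< B (rvec (Y i) w) >]] => /=.
    rewrite unfold_in /=; congr (is_true (Q _)) : Qw.
    by apply/setP => i; rewrite !inE ffunE.
  by move=> i; rewrite ffunE; case: asboolP.
move=> [s /= Qs sw]; rewrite unfold_in /= in Qs; congr (is_true (Q _)) : Qs.
apply/setP => i; rewrite !inE; have := sw i; case: (s i) => h.
  by apply/esym/asboolP.
by apply/esym/asboolP.
Qed.

Lemma measurable_sample_in_event (Q : pred {set 'I_n}) :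
  measurable [set w | Q (sample_in w)].
Proof.
by rewrite sample_in_eventE; apply: measurable_bigcup_fin => s; exact: measurable_sample_pattern.
Qed.

(** Independence and equality of laws give each pattern the probability [pattern_weight q s], so
    [pattern_tail] applies. *)
Lemma sample_in_tail (q k t : R) : P (rvec X @^-1` B) = q%:E ->
  n%:R * q <= k -> 0 < k -> 0 <= t <= k / 2 ->
  (P [set w | (t <= `|#|sample_in w|%:R - n%:R * q|)%R] <=
    (2 * expR (- (t ^+ 2 / (4 * k))))%:E)%E.
Proof.
move=> Bq nqk k0 tk; have q01 : 0 <= q <= 1.
  by rewrite -!lee_fin -Bq measure_ge0 probability_le1//; exact: measurable_rvec_preimage.
rewrite (sample_in_eventE (fun S => t <= `|#|S|%:R - n%:R * q|)).
apply: (le_trans (probability_bigcup_fin _ measurable_sample_pattern)).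
apply: le_trans (_ : (\sum_(s : {ffun 'I_n -> bool} | t <= `|\sum_i (s i)%:R - n%:R * q|)
    pattern_weight q s)%:E <= _)%E; last by rewrite lee_fin pattern_tail.
rewrite -sumEFin le_eqVlt; apply/orP; left; apply/eqP; apply: eq_big => [s|s _].
  rewrite /= -sum1_card natr_sum big_mkcond; congr (_ <= `|_ - _|).
  by apply: eq_bigr => i _; rewrite inE; case: (s i).
case: XY => indep law.
rewrite (indep (fun i => if s i then B else ~` B)); last first.
  by move=> i; case: ifP => // _; exact: measurableC.
rewrite -prodEFin; apply: eq_bigr => i _; have PB := law i B mB.
case: ifP => _; first by rewrite PB Bq.
by rewrite preimage_setC probability_setC ?PB ?Bq//; exact: measurable_rvec_preimage.
Qed.

End sample_tail.

(** * Copulas and tail correlations *)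

Section margins.
Context {disp : measure_display} {Omega : measurableType disp} {R : realType}
  {P : probability Omega R}.
Implicit Types X Y : {RV P >-> R}.

Lemma cdf_fine X x : (fine (cdf X x))%:E = cdf X x.
Proof.
rewrite fineK// ge0_fin_numE ?cdf_ge0//.
by rewrite (le_lt_trans (cdf_le1 _ _))// ltry.
Qed.

(** A sublevel set of a continuous cdf is closed and bounded above, hence a ray ending at its
    supremum, which acts as the u-quantile. It can be empty only at [u = 0], since the cdf tends to
    0 at minus infinity. *)
Lemma cdf_sublevel X (u : R) : continuous (cdf X) -> 0 <= u < 1 ->
  (u = 0 /\ forall x, (u%:E < cdf X x)%E) \/
  (exists s, cdf X s = u%:E /\ forall x, (cdf X x <= u%:E)%E = (x <= s)).
Proof.
move=> cX /andP[u0 u1]; pose F x := fine (cdf X x).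
have FE x : cdf X x = (F x)%:E by rewrite cdf_fine.
have Fmono x y : x <= y -> F x <= F y.
  by move=> xy; rewrite -lee_fin -!FE; exact: cdf_nondecreasing.
have Fcont : continuous F.
  by move=> x; apply: fine_cvg; rewrite -FE; exact: cX.
have [[x0 x0u]|ne] := pselect (exists x, F x <= u); last first.
  left; have ltF x : u < F x by rewrite ltNge; apply/negP => h; apply: ne; exists x.
  split; last by move=> x; rewrite FE lte_fin.
  apply/eqP; rewrite eq_le u0 andbT.
  have F0 : F x @[x --> -oo] --> 0 by apply: fine_cvg; exact: cvg_cdfNy0.
  by apply: (cvgr_to_ge F0); apply: nearW => x; exact: ltW.
right; pose S := F @^-1` [set x | x <= u].
have [x1 x1u] : exists x, u < F x.
  have F1 : F x @[x --> +oo] --> (1 : R) by apply: fine_cvg; exact: cvg_cdfy1.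
  apply: (@filter_ex _ (+oo%R : set_system R)); exact: (cvgr_gt _ F1 _ u1).
have ubS : ubound S x1.
  move=> x /= xu; rewrite leNgt; apply/negP => /ltW/Fmono.
  by rewrite leNgt (le_lt_trans xu x1u).
have Su : S (sup S).
  have clS : closed S by apply: closed_comp => // x _; exact: Fcont.
  suff : closure S (sup S) by rewrite -(closure_id S).1.
  by apply: closure_sup; [exists x0|exists x1].
have leS x : F x <= u -> x <= sup S.
  by move=> xu; apply: ub_le_sup => //; exists x1.
exists (sup S); split.
  rewrite FE; congr EFin; apply/eqP; rewrite eq_le Su/=.
  have x01 : x0 <= x1 by apply: ubS.
  (* Some c has [F c = u]; it lies below the supremum, so [F] there is at least u. *)
  have [||c _ Fc] := @IVT _ F _ _ u x01; first exact: continuous_subspaceT.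
    by rewrite ge_min x0u/= le_max (ltW x1u) orbT.
  by rewrite -[leLHS]Fc; apply: Fmono; apply: leS; rewrite Fc.
move=> x; rewrite FE lee_fin; apply/idP/idP; first exact: leS.
by move=> xs; exact: le_trans (Fmono _ _ xs) Su.
Qed.

Lemma measurable_cdf_sublevel X (u : R) : continuous (cdf X) -> 0 <= u < 1 ->
  measurable [set x : R | (cdf X x <= u%:E)%E].
Proof.
move=> cX /(cdf_sublevel cX)[[_ gt0]|[s [_ sE]]].
  rewrite (_ : [set _ | _] = set0)//; apply/seteqP; split => x //=.
  by rewrite leNgt gt0.
rewrite (_ : [set _ | _] = `]-oo, s]%classic); first exact: measurable_itv.
by apply/seteqP; split => x /=; rewrite in_itv/= sE.
Qed.

Lemma measurable_cdf_exceed X (u : R) : continuous (cdf X) -> 0 <= u < 1 ->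
  measurable [set x : R | (u%:E < cdf X x)%E].
Proof.
move=> cX u01; rewrite (_ : [set _ | _] = ~` [set x | (cdf X x <= u%:E)%E]).
  by apply: measurableC; exact: measurable_cdf_sublevel.
by apply/seteqP; split => x /=; rewrite ltNge => /negP.
Qed.

Lemma measurable_RV_preimage X (S : set R) : measurable S -> measurable (X @^-1` S).
Proof. by move=> mS; rewrite -[X in measurable X]setTI; exact: measurable_funP. Qed.

Lemma cdf_sublevel_prob X (u : R) : continuous (cdf X) -> 0 <= u < 1 ->
  P [set w | (cdf X (X w) <= u%:E)%E] = u%:E.
Proof.
move=> cX /(cdf_sublevel cX)[[-> gt0]|[s [<- sE]]].
  rewrite (_ : [set _ | _] = set0) ?measure0//; apply/seteqP; split => w //=.
  by rewrite leNgt gt0.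
rewrite /cdf /distribution /pushforward; congr (P _); apply/seteqP.
by split => w /=; rewrite in_itv/= -sE.
Qed.

(** Sklar's formula is evaluated at the two u-quantiles. If a quantile is missing then [u = 0], and
    both sides vanish since [C 0 0 = 0]. *)
Lemma copula_sublevel_prob X Y (C : R -> R -> R) (u : R) :
  continuous (cdf X) -> continuous (cdf Y) -> is_copula_of X Y C -> 0 <= u < 1 ->
  P [set w | (cdf X (X w) <= u%:E)%E /\ (cdf Y (Y w) <= u%:E)%E] = (C u u)%:E.
Proof.
move=> cX cY [[C0 _ _] CXY] u01.
have empty : u = 0 ->
    [set w | (cdf X (X w) <= u%:E)%E /\ (cdf Y (Y w) <= u%:E)%E] = set0 ->
    P [set w | (cdf X (X w) <= u%:E)%E /\ (cdf Y (Y w) <= u%:E)%E] = (C u u)%:E.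
  by move=> u0 ->; rewrite measure0 u0 (C0 0 _).1// lexx ler01.
have [[u0 gt0]|[s [sX sE]]] := cdf_sublevel cX u01.
  apply: empty => //; apply/seteqP; split => w //= [].
  by rewrite leNgt gt0.
have [[u0 gt0]|[t [tY tE]]] := cdf_sublevel cY u01.
  apply: empty => //; apply/seteqP; split => w //= [_].
  by rewrite leNgt gt0.
have := CXY s t; rewrite sX tY /= => <-; congr (P _); apply/seteqP.
by split => w /=; rewrite sE tE.
Qed.

Lemma measurable_sublevel X (u : R) : continuous (cdf X) -> 0 <= u < 1 ->
  measurable [set w | (cdf X (X w) <= u%:E)%E].
Proof. move=> cX u01. exact (measurable_RV_preimage X (measurable_cdf_sublevel cX u01)). Qed.

Lemma measurable_exceed X (u : R) : continuous (cdf X) -> 0 <= u < 1 ->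
  measurable [set w | (u%:E < cdf X (X w))%E].
Proof. move=> cX u01. exact (measurable_RV_preimage X (measurable_cdf_exceed cX u01)). Qed.

Lemma exceed_prob X (u : R) : continuous (cdf X) -> 0 <= u < 1 ->
  P [set w | (u%:E < cdf X (X w))%E] = (1 - u)%:E.
Proof.
move=> cX u01; rewrite (_ : [set _ | _] = ~` [set w | (cdf X (X w) <= u%:E)%E]).
  by rewrite probability_setC ?cdf_sublevel_prob//; exact: measurable_sublevel.
by apply/seteqP; split => w /=; rewrite ltNge => /negP.
Qed.

Lemma exceed_or_prob X Y (C : R -> R -> R) (u : R) :
  continuous (cdf X) -> continuous (cdf Y) -> is_copula_of X Y C -> 0 <= u < 1 ->
  P [set w | (u%:E < cdf X (X w))%E \/ (u%:E < cdf Y (Y w))%E] = (1 - C u u)%:E.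
Proof.
move=> cX cY CXY u01.
rewrite (_ : [set _ | _] =
    ~` [set w | (cdf X (X w) <= u%:E)%E /\ (cdf Y (Y w) <= u%:E)%E]).
  rewrite probability_setC ?(copula_sublevel_prob cX cY CXY)//.
  by apply: measurableI; exact: measurable_sublevel.
apply/seteqP; split => w /=; first by case; rewrite ltNge => /negP h [].
by move/not_andP => -[] /negP; rewrite -ltNge; [left|right].
Qed.

(** Inclusion-exclusion: [(1 - u) + (1 - u) - (1 - C u u)] is the survival copula at [1 - u]. *)
Lemma exceed_and_prob X Y (C : R -> R -> R) (u : R) :
  continuous (cdf X) -> continuous (cdf Y) -> is_copula_of X Y C -> 0 <= u < 1 ->
  P [set w | (u%:E < cdf X (X w))%E /\ (u%:E < cdf Y (Y w))%E] =
    (copula_bar C (1 - u) (1 - u))%:E.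
Proof.
move=> cX cY CXY u01.
have mX := measurable_exceed cX u01; have mY := measurable_exceed cY u01.
have PX := exceed_prob cX u01; have PY := exceed_prob cY u01.
have PU := exceed_or_prob cX cY CXY u01.
move: PX PY PU mX mY; set EX := [set w | (u%:E < cdf X (X w))%E].
set EY := [set w | (u%:E < cdf Y (Y w))%E] => PX PY PU mX mY.
have UE : (P (EX `|` EY) = P EX + P EY - P (EX `&` EY))%E.
  by apply: measureUfinl => //; apply: le_lt_trans (probability_le1 P mX) _; exact: ltry.
have PI : P (EX `&` EY) \is a fin_num by apply: fin_num_measure; exact: measurableI.
change (P (EX `&` EY) = (copula_bar C (1 - u) (1 - u))%:E).
move: UE; rewrite [LHS](PU : P (EX `|` EY) = _) PX PY -(fineK PI) => -[e].
by congr EFin; rewrite /copula_bar !subKr; lra.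
Qed.

End margins.

Section tail_correlation.
Context {R : realType}.
Implicit Types C : R -> R -> R.

(** With [u = 1 - 1 / t] this is [0 <= C u u <= u], obtained from the rectangles [0,u] x [0,u] and
    [0,u] x [u,1]. *)
Lemma chi_at_bounds C (t : R) : is_copula C -> 1 <= t -> 2 - t <= chi_at C t <= 1.
Proof.
move=> [C0 C1 Cinc] t1; have t0 : 0 < t by lra.
have ti : 0 < t^-1 <= 1 by rewrite invr_gt0 t0 invf_le1.
set u := 1 - 1 / t; have u0 : 0 <= u by rewrite /u; lra.
have u1 : u <= 1 by rewrite /u; lra.
have u01 : 0 <= u <= 1 by rewrite u0.
have i01 : 0 <= (1 : R) <= 1 by rewrite lexx ler01.
have h1 := Cinc 0 u 0 u (lexx _) u0 u1 (lexx _) u0 u1.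
have h2 := Cinc 0 u u 1 (lexx _) u0 u1 u0 u1 (lexx _).
have [c1 c2] := C0 u u01; have [c3 c4] := C1 u u01.
have [c5 c6] := C0 1 i01; have [c7 _] := C0 0 (andb_true_intro (conj (lexx 0) ler01)).
have Cuu0 : 0 <= C u u by lra.
have Cuuu : C u u <= u by lra.
rewrite /chi_at /copula_bar -/u.
have -> : t * (1 / t + 1 / t - 1 + C u u) = 2 - t + t * C u u.
  by field; rewrite gt_eqF.
have : 0 <= t * C u u by rewrite mulr_ge0// ltW.
have : t * C u u <= t * u by rewrite ler_wpM2l// ltW.
have -> : t * u = t - 1 by rewrite /u; field; rewrite gt_eqF.
by move=> *; apply/andP; split; lra.
Qed.

(* The class only constrains [t > 1]; at [t = 1] the bound survives by
   continuity. *)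
Lemma second_order_ge1 C (rho M t : R) : 0 < rho ->
  second_order_class rho M C -> 1 <= t ->
  `|chi_at C t - chi_lim C| <= M * t `^ (- rho).
Proof.
move=> rho0 [[cop _] bnd]; rewrite le_eqVlt => /predU1P[<-|]; last exact: bnd.
rewrite powR1 mulr1.
have chi1 : chi_at C 1 = 1.
  have := chi_at_bounds cop (lexx 1); rewrite (_ : 2 - 1 = 1) => [h|]; last lra.
  by apply/eqP; rewrite eq_le andbC.
rewrite chi1; apply/ler_addgt0Pr => e e0.
(* At [1 + e] the value of [chi_at] lies between [1 - e] and 1, so moving there from 1 costs at most
   e. *)
have t1 : 1 < 1 + e by lra.
have /andP[h1 h2] := chi_at_bounds cop (ltW t1).
have M0 : 0 <= M.
  have := le_trans (normr_ge0 _) (bnd _ t1); rewrite pmulr_lge0// powR_gt0//; lra.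
have h3 : `|chi_at C (1 + e) - chi_lim C| <= M.
  apply: (le_trans (bnd _ t1)); rewrite ler_piMr// -[leRHS](powRr0 (1 + e)).
  by rewrite ler_powR; lra.
by move: h3; rewrite !ler_norml => /andP[? ?]; apply/andP; split; lra.
Qed.

End tail_correlation.

(** The stable tail dependence function is evaluated at the indicator of {j, l}. As max is sum minus
    min and rows sum to 1, the model gives [2 - tail_cor A j l]; the prelimit at m is
    [2 - chi_at C m]. *)
Lemma chi_lim_tail_cor {disp : measure_display} {Omega : measurableType disp} {R : realType}
    {P : probability Omega R} (d K : nat) (A : 'M[R]_(d, K)) (X : 'I_d -> {RV P >-> R})
    (C : R -> R -> R) (j l : 'I_d) :
  in_Theta_L A -> continuous_margins X -> has_stdf X (stdf_of A) -> j != l ->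
  is_copula_of (X j) (X l) C -> copulas2 C -> chi_lim C = tail_cor A j l.
Proof.
move=> Th cX stdf jl copC [_ cvC].
pose x i : R := ((i == j) || (i == l))%:R.
have x0 i : 0 <= x i by rewrite /x.
have stdfx : stdf_of A x = 2 - tail_cor A j l.
  rewrite /stdf_of /tail_cor.
  have -> : (2 : R) = \sum_a (A j a + A l a) by rewrite big_split/= !Theta_sum1.
  rewrite -sumrB; apply: eq_bigr => a _.
  have -> : A j a + A l a - Num.min (A j a) (A l a) = Num.max (A j a) (A l a).
    by rewrite -(addr_max_min (A j a)) addrK.
  apply/eqP; rewrite eq_le; apply/andP; split.
    apply: bigmax_le => [|i _]; first by rewrite le_max Theta_ge0.
    rewrite /x; case: (eqVneq i j) => [->|_]; first by rewrite mulr1 le_max lexx.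
    case: (eqVneq i l) => [->|_]; first by rewrite mulr1 le_max lexx orbT.
    by rewrite mulr0 le_max Theta_ge0.
  rewrite ge_max; apply/andP; split.
    by apply: le_trans (le_bigmax _ _ j); rewrite /x eqxx mulr1.
  by apply: le_trans (le_bigmax _ _ l); rewrite /x eqxx orbT mulr1.
have cvm : (2 - chi_at C m%:R) @[m --> \oo] --> 2 - chi_lim C.
  apply: cvgB; first exact: cvg_cst.
  exact: (cvg_comp _ _ (@cvgr_idn R) cvC).
have := stdf x x0; rewrite stdfx => /fine_cvgP[_] cvL.
suff : 2 - chi_lim C = 2 - tail_cor A j l by lra.
apply: (cvg_unique _ cvm) => //; apply: cvg_trans cvL.
apply: near_eq_cvg; near=> m.
have m2 : (1 < m)%N by near: m; exists 2%N.
have m0 : 0 < m%:R :> R by rewrite ltr0n; exact: ltn_trans m2.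
have mi : 0 < (m%:R^-1 : R) <= 1 by rewrite invr_gt0 m0 invf_le1// ler1n; exact: ltnW.
pose u : R := 1 - m%:R^-1; have u01 : 0 <= u < 1 by rewrite /u; lra.
rewrite /= (_ : [set w | _] =
  [set w | (u%:E < cdf (X j) (X j w))%E \/ (u%:E < cdf (X l) (X l w))%E]); last first.
  apply/seteqP; split => w /=.
    move=> [i]; rewrite /x; case: (eqVneq i j) => [->|_]; first by rewrite mul1r; left.
    case: (eqVneq i l) => [->|_]; first by rewrite mul1r; right.
    (* A coordinate with weight 0 would need a cdf value above 1. *)
    by rewrite mul0r subr0 ltNge cdf_le1.
  by case => h; [exists j|exists l]; rewrite /x eqxx ?orbT mul1r.
rewrite (exceed_or_prob (cX j) (cX l) copC u01) -EFinM /=.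
rewrite /chi_at /copula_bar !div1r -/u /u; field.
by rewrite gt_eqF.
Unshelve. all: by end_near.
Qed.

(** * Concentration of the empirical tail correlations *)

Section concentration.
Context {disp : measure_display} {Omega : measurableType disp} {R : realType}
  {P : probability Omega R}.
Variables (n d K : nat) (A : 'M[R]_(d, K)) (X : 'I_d -> {RV P >-> R})
  (Xs : 'I_n -> 'I_d -> {RV P >-> R}) (C : 'I_d -> 'I_d -> R -> R -> R)
  (r M t : R) (k : nat).
Hypotheses (Theta : in_Theta_L A) (cX : continuous_margins X)
  (stdfX : has_stdf X (stdf_of A)) (iidX : iid_sample X Xs)
  (copX : forall j l : 'I_d, (j < l)%N -> is_copula_of (X j) (X l) (C j l))
  (C2 : forall j l : 'I_d, (j < l)%N -> second_order_class r M (C j l))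
  (r0 : 0 < r) (M0 : 0 <= M) (kn : (1 <= k <= n)%N) (tk : 0 <= t <= k%:R / 2).

Let u : R := 1 - k%:R / n%:R.

Let k0 : 0 < k%:R :> R. Proof. by rewrite ltr0n; case/andP: kn. Qed.

Let n0 : 0 < n%:R :> R.
Proof. by rewrite ltr0n; case/andP: kn; exact: leq_trans. Qed.

Let u01 : 0 <= u < 1.
Proof.
have k1 : k%:R / n%:R <= 1 :> R.
  by rewrite ler_pdivrMr// mul1r ler_nat; case/andP: kn.
have : 0 < k%:R / n%:R :> R by rewrite divr_gt0.
by rewrite /u => ?; apply/andP; split; lra.
Qed.

(** Diagonal pairs encode single exceedances, so one family indexed by pairs covers marginal and
    joint counts. *)
Definition joint_exceed (p : 'I_d * 'I_d) : set (d.-tuple (measurableTypeR R)) :=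
  [set y | (u%:E < cdf (X p.1) (tnth y p.1))%E /\ (u%:E < cdf (X p.2) (tnth y p.2))%E].

Lemma measurable_joint_exceed p : measurable (joint_exceed p).
Proof.
suff m j : measurable [set y : d.-tuple (measurableTypeR R) | (u%:E < cdf (X j) (tnth y j))%E].
  exact (measurableI _ _ (m p.1) (m p.2)).
have mj := @measurable_tnth _ (measurableTypeR R) d j.
have := mj measurableT _ (measurable_cdf_exceed (@cX j) u01).
by rewrite setTI.
Qed.

Let q p := fine (P (rvec X @^-1` joint_exceed p)).

Let qE p : P (rvec X @^-1` joint_exceed p) = (q p)%:E.
Proof.
by rewrite /q fineK// fin_num_measure//; apply: measurable_rvec_preimage; exact: measurable_joint_exceed.
Qed.

Let preim_joint p : rvec X @^-1` joint_exceed p =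
  [set w | (u%:E < cdf (X p.1) (X p.1 w))%E /\ (u%:E < cdf (X p.2) (X p.2 w))%E].
Proof. by apply/seteqP; split => w; rewrite /preimage /joint_exceed /= !tnth_mktuple. Qed.

Let q_diag j : n%:R * q (j, j) = k%:R.
Proof.
rewrite /q preim_joint /= (_ : [set w | _] = [set w | (u%:E < cdf (X j) (X j w))%E]).
  rewrite (exceed_prob (@cX j) u01) /= /u opprB addrC subrK mulrC divfK//.
  by rewrite gt_eqF.
by apply/seteqP; split => w /=; [case|].
Qed.

Let q_le p : n%:R * q p <= k%:R.
Proof.
rewrite -(q_diag p.1) ler_wpM2l ?(ltW n0)// -lee_fin -!qE le_measure// ?inE.
- by apply: measurable_rvec_preimage; exact: measurable_joint_exceed.
- by apply: measurable_rvec_preimage; exact: measurable_joint_exceed.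
- by rewrite !preim_joint => w /= [].
Qed.

Let q_sym j l : q (j, l) = q (l, j).
Proof.
by rewrite /q !preim_joint /=; congr (fine (P _)); apply/seteqP; split => w /= [].
Qed.

Let q_close_lt (j l : 'I_d) : (j < l)%N ->
  `|k%:R^-1 * (n%:R * q (j, l)) - tail_cor A j l| <= M * (k%:R / n%:R) `^ r.
Proof.
move=> jl; have C2jl := C2 jl; have njl : j != l by rewrite -val_eqE ltn_eqF.
(* Equality occurs when [k = n], whence the use of [second_order_ge1]. *)
have t1 : 1 <= n%:R / k%:R :> R.
  by rewrite ler_pdivlMr// mul1r ler_nat; case/andP: kn.
have := second_order_ge1 r0 C2jl t1.
rewrite (chi_lim_tail_cor Theta cX stdfX njl (copX jl) C2jl.1).
have -> : (k%:R / n%:R) `^ r = (n%:R / k%:R) `^ (- r).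
  have e : k%:R / n%:R = (n%:R / k%:R) `^ (- 1) :> R.
    by rewrite powR_inv1 ?invf_div// divr_ge0.
  by rewrite e -powRrM mulN1r.
have -> // : k%:R^-1 * (n%:R * q (j, l)) = chi_at (C j l) (n%:R / k%:R).
rewrite /q preim_joint (exceed_and_prob (@cX j) (@cX l) (copX jl) u01) /=.
by rewrite /chi_at mulrA [_^-1 * _]mulrC div1r invf_div /u subKr.
Qed.

Let q_close j l : j != l ->
  `|k%:R^-1 * (n%:R * q (j, l)) - tail_cor A j l| <= M * (k%:R / n%:R) `^ r.
Proof.
have [jl _|lj _|/val_inj ->] := ltngtP j l; last by rewrite eqxx.
- exact: q_close_lt.
- by rewrite q_sym tail_corC; exact: q_close_lt.
Qed.

Let N p w := #|sample_in Xs (joint_exceed p) w|%:R : R.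

Definition deviation_event : set Omega :=
  \bigcup_(p in [set` [pred p : 'I_d * 'I_d | true]]) [set w | t <= `|N p w - n%:R * q p|].

Let measurable_deviation p : measurable [set w | t <= `|N p w - n%:R * q p|].
Proof.
exact: (measurable_sample_in_event Xs (measurable_joint_exceed p)
  (fun S => t <= `|#|S|%:R - n%:R * q p|)).
Qed.

Lemma measurable_deviation_event : measurable deviation_event.
Proof. by apply: measurable_bigcup_fin; exact: measurable_deviation. Qed.

Lemma deviation_event_le :
  (P deviation_event <= (d%:R ^+ 2 * (2 * expR (- (t ^+ 2 / (4 * k%:R)))))%:E)%E.
Proof.
apply: le_trans (probability_bigcup_fin _ _ measurable_deviation) _.
apply: (@le_trans _ _ (\sum_(p : 'I_d * 'I_d) (2 * expR (- (t ^+ 2 / (4 * k%:R))))%:E)%E).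
  apply: lee_sum => p _.
  exact: (sample_in_tail iidX (measurable_joint_exceed p) (qE p) (q_le p)).
rewrite sumEFin lee_fin sumr_const card_prod card_ord -[_ *+ (_ * _)]mulr_natl natrM.
by rewrite expr2.
Qed.

(** Passing from ranks to quantiles costs two marginal deviations, passing from counts to
    expectations one joint deviation, each at most [t / k]; the remaining error is the second order
    bias. *)
Lemma chi_hat_concentration w (rk : 'I_n -> 'I_d -> nat) : ~ deviation_event w ->
  (forall j, is_ranking (fun i => Xs i j w) (rk ^~ j)) ->
  forall j l, `|chi_hat k rk j l - tail_cor A j l| <=
    M * (k%:R / n%:R) `^ r + 3 * t / k%:R.
Proof.
move=> good rkP j l; case/andP: (tk) => t0 _.
have Ndev p : `|N p w - n%:R * q p| <= t.
  by rewrite leNgt; apply/negP => /ltW h; apply: good; exists p.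
have [->|jl] := eqVneq j l.
  rewrite (chi_hat_diag kn (rkP l)) tail_cor_diag// subrr normr0 addr_ge0//.
    by rewrite mulr_ge0// powR_ge0.
  by rewrite divr_ge0 ?mulr_ge0// ltW.
pose B m := sample_in Xs (joint_exceed (m, m)) w.
have Bup m i i' : Xs i m w <= Xs i' m w -> i \in B m -> i' \in B m.
  move=> le; rewrite !inE.
  rewrite /joint_exceed /= !tnth_mktuple => -[h _].
  by have h' := lt_le_trans h (cdf_nondecreasing (X m) le); split.
have BI : (B j :&: B l)%SET = sample_in Xs (joint_exceed (j, l)) w.
  apply/setP => i; rewrite !inE; apply/andP/idP.
    by move=> [/asboolW[h _] /asboolW[h' _]]; apply: asboolT.
  by move=> /asboolW[h h']; split; apply: asboolT.
have kn' : (k <= n)%N by case/andP: kn.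
have h1 := chi_hat_upset j l kn' rkP Bup.
have h2 := q_close jl; have h3 := Ndev (j, l).
have hj := Ndev (j, j); have hl := Ndev (l, l); rewrite !q_diag in hj hl.
rewrite BI -/(N (j, l) w) -/(N (j, j) w) -/(N (l, l) w) in h1.
have ki : 0 <= k%:R^-1 :> R by rewrite invr_ge0 ltW.
have h1' : `|chi_hat k rk j l - k%:R^-1 * N (j, l) w| <= k%:R^-1 * (t + t).
  by apply: (le_trans h1); rewrite ler_wpM2l// lerD.
have h3' : `|k%:R^-1 * N (j, l) w - k%:R^-1 * (n%:R * q (j, l))| <= k%:R^-1 * t.
  by rewrite -mulrBr normrM ger0_norm// ler_wpM2l.
have -> : M * (k%:R / n%:R) `^ r + 3 * t / k%:R =
  k%:R^-1 * (t + t) + (k%:R^-1 * t + M * (k%:R / n%:R) `^ r) by ring.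
apply: le_trans (lerD h1' (lerD h3' h2)).
have -> : chi_hat k rk j l - tail_cor A j l =
  (chi_hat k rk j l - k%:R^-1 * N (j, l) w) +
  ((k%:R^-1 * N (j, l) w - k%:R^-1 * (n%:R * q (j, l))) +
  (k%:R^-1 * (n%:R * q (j, l)) - tail_cor A j l)) by ring.
by apply: le_trans (ler_normD _ _) _; rewrite lerD2l ler_normD.
Qed.

(** Hides the bad event behind an existential, so that a sequence of such events can be chosen over
    n. *)
Lemma chi_hat_concentration_event : exists B : set Omega,
  [/\ measurable B,
      (P B <= (d%:R ^+ 2 * (2 * expR (- (t ^+ 2 / (4 * k%:R)))))%:E)%E &
      forall w, ~ B w -> forall rk : 'I_n -> 'I_d -> nat,
        (forall j, is_ranking (fun i => Xs i j w) (rk ^~ j)) ->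
        forall j l, `|chi_hat k rk j l - tail_cor A j l| <=
          M * (k%:R / n%:R) `^ r + 3 * t / k%:R].
Proof.
exists deviation_event; split.
- exact: measurable_deviation_event.
- exact: deviation_event_le.
- by move=> w Bw rk; exact: chi_hat_concentration.
Qed.

End concentration.

(** * Rates *)

Section tuning.
Context {R : realType}.

(* With [z = L / N] and [y = z `^ (r / (2 * r + 1))], the number [x] of which
   [k] is the integer part satisfies [x * y ^+ 2 = ck * L] and
   [(x / N) `^ r = ck `^ r * y]. *)
Lemma tuning_bounds (r L N ck ckap M : R) (k : nat)
    (y := (L / N) `^ (r / (2 * r + 1))) :
  0 < r -> 1 <= L -> 0 < N -> 0 < ck -> 0 <= M ->
  M * ck `^ r + 9 * ck `^ (- 2^-1) + 5 * ck^-1 <= ckap ->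
  100 * y ^+ 2 <= ck ->
  k = Num.truncn (ck * L `^ (1 / (2 * r + 1)) * N `^ (2 * r / (2 * r + 1))) ->
  32 * L <= k%:R /\
  M * (k%:R / N) `^ r + 3 * Num.sqrt (8 * L * k%:R) / k%:R <= ckap * y.
Proof.
move=> r0 L1 N0 ck0 M0 hc y100; set x := ck * _ * _ => kx.
have L0 : 0 < L by lra.
have r1 : 2 * r + 1 != 0 by rewrite gt_eqF; lra.
pose z := L / N; have z0 : 0 < z by rewrite divr_gt0.
have LE : L = z * N by rewrite /z divfK// gt_eqF.
have y0 : 0 < y by rewrite powR_gt0.
have xE : x = ck * z `^ (1 / (2 * r + 1)) * N.
  rewrite /x LE powRM ?(ltW z0) ?(ltW N0)// -!mulrA; congr (_ * (_ * _)).
  rewrite -powRD ?(gt_eqF N0) ?implybT// -[RHS]powRr1 ?ltW//; congr (_ `^ _).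
  by field.
have xy : x * y ^+ 2 = ck * L.
  rewrite xE LE -powR_mulrn ?powR_ge0// /y -/z -powRrM.
  have zz : z `^ (1 / (2 * r + 1)) * z `^ (r / (2 * r + 1) * 2%:R) = z.
    rewrite -powRD ?(gt_eqF z0) ?implybT// -[RHS]powRr1 ?(ltW z0)//.
    by congr (_ `^ _); field.
  set a := z `^ _ in zz *; set b := z `^ _ in zz *.
  have -> : ck * a * N * b = ck * (a * b) * N by ring.
  by rewrite zz mulrA.
have y20 : 0 < y ^+ 2 by rewrite exprn_gt0.
have x100 : 100 * L <= x.
  by rewrite -(ler_pM2r y20) xy mulrAC ler_pM2r.
have x0 : 0 < x by lra.
have kle : k%:R <= x by rewrite kx truncn_le// ltW.
have kge : x < k%:R + 1.
  by have := truncnS_gt x; rewrite -kx -natr1.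
(* Since [x >= 100] and [k > x - 1], rounding costs at most a factor 9/8, which turns the 8 under
   the square root into the square of 3. *)
have k98 : 8 * x <= 9 * k%:R by lra.
have k0 : 0 < k%:R :> R by lra.
split; first lra.
have h1 : (k%:R / N) `^ r <= ck `^ r * y.
  have -> : ck `^ r * y = (x / N) `^ r.
    rewrite xE mulfK ?(gt_eqF N0)// powRM ?powR_ge0 ?(ltW ck0)//; congr (_ * _).
    by rewrite -powRrM; congr (_ `^ _); field.
  by rewrite ge0_ler_powR ?nnegrE ?(ltW r0) ?divr_ge0 ?(ltW N0) ?(ltW x0)// ler_pM2r ?invr_gt0.
set g := ck `^ (- 2^-1) in hc *.
have g0 : 0 < g by rewrite powR_gt0.
have gck : g ^+ 2 * ck = 1.
  rewrite -powR_mulrn ?powR_ge0// -powRrM mulNr mulVf ?pnatr_eq0//.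
  by rewrite powR_inv1 ?ltW// mulVf ?gt_eqF.
(* After squaring and multiplying by [x * ck], the identities [g ^+ 2 * ck = 1] and
   [x * y ^+ 2 = ck * L] reduce the claim to [8 * x <= 9 * k]. *)
have h2 : Num.sqrt (8 * L * k%:R) <= 3 * k%:R * g * y.
  have p0 : 0 <= 3 * k%:R * g * y by rewrite !mulr_ge0 ?ltW.
  rewrite -[leRHS](ger0_norm p0) -sqrtr_sqr ler_wsqrtr//.
  rewrite -(ler_pM2r (mulr_gt0 x0 ck0)).
  have -> : (3 * k%:R * g * y) ^+ 2 * (x * ck) =
    9 * k%:R * k%:R * (g ^+ 2 * ck) * (x * y ^+ 2) by ring.
  rewrite gck xy mulr1.
  have -> : 8 * L * k%:R * (x * ck) = 8 * x * (k%:R * (ck * L)) by ring.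
  have -> : 9 * k%:R * k%:R * (ck * L) = 9 * k%:R * (k%:R * (ck * L)) by ring.
  by rewrite ler_wpM2r// !mulr_ge0 ?ltW.
have h3 : 3 * Num.sqrt (8 * L * k%:R) / k%:R <= 9 * g * y.
  rewrite ler_pdivrMr//.
  have -> : 9 * g * y * k%:R = 3 * (3 * k%:R * g * y) by ring.
  by rewrite ler_wpM2l.
have h4 : M * (k%:R / N) `^ r <= M * (ck `^ r * y) by rewrite ler_wpM2l.
apply: le_trans (lerD h4 h3) _.
have ck1 : 0 < ck^-1 by rewrite invr_gt0.
have := ler_wpM2r (ltW y0) hc; have : 0 <= 5 * ck^-1 * y by rewrite !mulr_ge0 ?ltW.
by rewrite !mulrDl; lra.
Qed.

Lemma expR1_le4 : expR 1 <= 4 :> R.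
Proof.
have h := expR_ge1Dx (- 2^-1 : R); rewrite expRN in h.
have e0 := expR_gt0 (2^-1 : R); have h2 : expR 2^-1 <= 2 :> R.
  by rewrite -lef_pV2 ?posrE//; apply: le_trans h; lra.
have -> : (1 : R) = 2^-1 + 2^-1 by lra.
rewrite expRD; apply: (@le_trans _ _ (2 * 2)); last lra.
by rewrite ler_pM// ltW.
Qed.

Lemma ln_le_sqrt (x : R) : 0 <= x -> ln x <= 2 * Num.sqrt x.
Proof.
move=> x0; have [->|xn0] := eqVneq x 0; first by rewrite ln0 ?mulr_ge0// sqrtr_ge0.
have s0 : 0 < Num.sqrt x by rewrite sqrtr_gt0 lt0r xn0.
rewrite -{1}(sqr_sqrtr x0) lnXn// mulr_natl.
have h : -1 < Num.sqrt x - 1 by lra.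
by have := le_ln1Dx h; rewrite addrC subrK; lra.
Qed.

End tuning.

Section asymptotics.
Context {R : realType}.

Lemma log_ratio_small (d : nat -> nat) (e : R) : (forall n, (0 < n)%N -> (2 <= d n)%N) ->
  (fun n => ln (d n)%:R : R) =o_\oo (fun n => n%:R : R) -> 0 < e ->
  \forall n \near \oo, ln (4 * (d n)%:R * n%:R ^+ 2) / n%:R <= e.
Proof.
move=> d2 /eqoP odo e0; have e2 : 0 < e / 2 by rewrite divr_gt0.
near=> n; have n0 : (0 < n)%N by near: n; exists 1%N.
have N0 : 0 < n%:R :> R by rewrite ltr0n.
have D0 : 0 < (d n)%:R :> R by rewrite ltr0n (leq_trans _ (d2 _ n0)).
(* The factor [d n] is controlled by [ln (d n) = o(n)], the factor [(2 * n) ^+ 2] by [ln_le_sqrt];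
   each takes half of [e]. *)
have -> : 4 * (d n)%:R * n%:R ^+ 2 = (d n)%:R * (2 * n%:R) ^+ 2 :> R by ring.
have N2 : 0 < 2 * n%:R :> R by rewrite mulr_gt0.
rewrite ler_pdivrMr// lnM ?posrE ?exprn_gt0// lnXn//.
have h1 : ln (d n)%:R <= e / 2 * n%:R.
  apply: (le_trans (ler_norm _)); rewrite -[X in _ <= _ * X](@ger0_norm _ n%:R)//.
  by near: n; exact: odo.
have h2 : ln (2 * n%:R) *+ 2 <= e / 2 * n%:R.
  apply: (@le_trans _ _ ((2 * Num.sqrt (2 * n%:R)) *+ 2)).
    by rewrite lerMn2r/= ln_le_sqrt// ltW.
  have p0 : 0 <= e / 2 * n%:R by rewrite mulr_ge0 ?ltW.
  rewrite -mulr_natr mulrAC -[leRHS](ger0_norm p0) -sqrtr_sqr.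
  have -> : 2 * 2%:R = Num.sqrt (4 ^+ 2) :> R by rewrite sqrtr_sqr ger0_norm//; ring.
  rewrite -sqrtrM ?sqr_ge0// ler_wsqrtr//.
  have -> : (e / 2 * n%:R) ^+ 2 = e ^+ 2 / 4 * n%:R * n%:R :> R by field.
  rewrite mulrA ler_pM2r// -ler_pdivrMl ?divr_gt0 ?exprn_gt0//.
  by near: n; exact: nbhs_infty_ger.
by have := lerD h1 h2; rewrite -mulrDl -splitr.
Unshelve. all: by end_near. Qed.

(** The exponent increases with r, so it is at least its value [a] at [rho]. Once the base is below
    1 its [a]-th power dominates, uniformly in r. *)
Lemma log_rate_small (d : nat -> nat) (r : nat -> R) (rho e : R) :
  (forall n, (0 < n)%N -> (2 <= d n)%N) ->
  (fun n => ln (d n)%:R : R) =o_\oo (fun n => n%:R : R) ->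
  0 < rho -> (forall n, (0 < n)%N -> rho <= r n) -> 0 < e ->
  \forall n \near \oo,
    (ln (4 * (d n)%:R * n%:R ^+ 2) / n%:R) `^ (r n / (2 * r n + 1)) <= e.
Proof.
move=> d2 odo rho0 hr e0; pose a := rho / (2 * rho + 1).
have a0 : 0 < a by rewrite divr_gt0//; lra.
near=> n; have n0 : (0 < n)%N by near: n; exists 1%N.
have N0 : 0 < n%:R :> R by rewrite ltr0n.
have z1 : ln (4 * (d n)%:R * n%:R ^+ 2) / n%:R <= 1 :> R.
  by near: n; exact: (log_ratio_small d2 odo ltr01).
have ze : ln (4 * (d n)%:R * n%:R ^+ 2) / n%:R <= e `^ a^-1 by near: n; exact: (log_ratio_small d2 odo (powR_gt0 _ e0)).
set z := _ / _ in z1 ze *; have z0 : 0 < z.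
  rewrite divr_gt0// ln_gt0// -natrX -!natrM ltr1n.
  by rewrite -mulnA (leq_trans (_ : 2 <= 4 * 1)%N)// leq_mul// muln_gt0 expn_gt0 n0 (leq_trans _ (d2 _ n0)).
have ae : a <= r n / (2 * r n + 1).
  have := hr _ n0 => hrn; rewrite /a ler_pdivrMr; last lra.
  by rewrite mulrAC ler_pdivlMr; lra.
apply: (@le_trans _ _ (z `^ a)); first by rewrite ger_powR// z0 z1.
apply: (@le_trans _ _ ((e `^ a^-1) `^ a)).
  by rewrite ge0_ler_powR ?nnegrE ?(ltW a0) ?(ltW z0) ?powR_ge0.
by rewrite -powRrM mulVf ?gt_eqF// powRr1// ltW.
Unshelve. all: by end_near. Qed.

(** As [2 <= d], [4 * d * n ^+ 2 <= (n * d) ^+ 3]; the resulting factor 3 to the power e is at most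
    3. *)
Lemma log_ratio_compare (d n : nat) (e : R) : (2 <= d)%N -> (0 < n)%N -> 0 <= e <= 1 ->
  (ln (4 * d%:R * n%:R ^+ 2) / n%:R) `^ e <= 3 * (ln (n%:R * d%:R) / n%:R) `^ e.
Proof.
move=> d2 n0 /andP[e0 e1].
have N0 : 0 < n%:R :> R by rewrite ltr0n.
have D2 : 2 <= d%:R :> R by rewrite ler_nat.
have N1 : 1 <= n%:R :> R by rewrite ler1n.
have nd : 1 <= n%:R * d%:R :> R.
  by rewrite -natrM ler1n muln_gt0 n0 (leq_trans _ d2).
have L3 : ln (4 * d%:R * n%:R ^+ 2) <= 3 * ln (n%:R * d%:R) :> R.
  rewrite [leRHS]mulr_natl -lnXn ?(lt_le_trans ltr01)//.
  have le4 : 4 * d%:R * n%:R ^+ 2 <= (n%:R * d%:R) ^+ 3 :> R.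
    rewrite -!natrX -!natrM -natrX ler_nat expnMn.
    rewrite [leqRHS](_ : _ = (d ^ 2 * n) * d * n ^ 2)%N; last by rewrite !expnS !expn0; lia.
    by rewrite !leq_mul// (leq_trans (_ : 4 <= 2 ^ 2 * 1)%N)// leq_mul// leq_exp2r.
  have p0 : 0 < 4 * d%:R * n%:R ^+ 2 :> R by rewrite !mulr_gt0 ?exprn_gt0 ?(lt_le_trans _ D2).
  by rewrite ler_ln ?posrE// (lt_le_trans p0 le4).
have l0 : 0 <= ln (n%:R * d%:R) / n%:R :> R by rewrite divr_ge0 ?ln_ge0 ?(ltW N0).
have l4 : 0 <= ln (4 * d%:R * n%:R ^+ 2) / n%:R :> R.
  rewrite divr_ge0 ?(ltW N0)// ln_ge0//.
  by rewrite -natrX -!natrM ler1n !muln_gt0 n0 (leq_trans _ d2).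
apply: (@le_trans _ _ ((3 * (ln (n%:R * d%:R) / n%:R)) `^ e)).
  apply: ge0_ler_powR; rewrite ?nnegrE ?(mulr_ge0 _ l0)//.
  by rewrite mulrA ler_pM2r ?invr_gt0.
rewrite powRM// ler_wpM2r ?powR_ge0// ler1_powR//; lra.
Qed.

Lemma sum_inv_sqr_le (m : nat) : \sum_(0 <= i < m) (i%:R ^+ 2)^-1 <= 2 :> R.
Proof.
suff h j : \sum_(0 <= i < j.+2) (i%:R ^+ 2)^-1 <= 2 - j.+1%:R^-1 :> R.
  apply: (@le_trans _ _ (\sum_(0 <= i < m.+2) (i%:R ^+ 2)^-1)); last first.
    by apply: (le_trans (h m)); rewrite gerDl oppr_le0 invr_ge0.
  rewrite (@big_cat_nat _ _ _ m 0 m.+2)//=; last by rewrite ltnW.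
  by rewrite lerDl sumr_ge0// => i _; rewrite invr_ge0 sqr_ge0.
elim: j => [|j ih].
  (* The term at [i = 0] is the inverse of 0, which is 0 by convention. *)
  by rewrite !big_nat_recr//= big_nil expr0n/= invr0 !add0r expr1n invr1; lra.
rewrite big_nat_recr//=; apply: (le_trans (lerD ih (lexx _))).
have j1 : 0 < j.+1%:R :> R by rewrite ltr0n.
have -> : j.+2%:R = j.+1%:R + 1 :> R by rewrite -natr1.
set x := j.+1%:R in j1 *.
have -> : 2 - (x + 1)^-1 = 2 - x^-1 + (x * (x + 1))^-1.
  by field; rewrite !gt_eqF//; lra.
rewrite lerD2l lef_pV2 ?posrE ?exprn_gt0 ?mulr_gt0//; [|lra|lra].
by rewrite expr2 ler_wpM2r//; lra.
Qed.

Lemma limn_esup_lty (v : nat -> \bar R) (c : R) :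
  (\forall n \near \oo, (v n <= c%:E)%E) -> (limn_esup v < +oo)%E.
Proof.
move=> vc; apply: (@le_lt_trans _ _ c%:E); last exact: ltry.
rewrite /limn_esup limf_esupE; apply: (@le_trans _ _ (ereal_sup (v @` [set n | (v n <= c%:E)%E]))).
  by apply: ereal_inf_lbound; exists [set n | (v n <= c%:E)%E].
by apply: ge_ereal_sup => _ [n /= vn <-].
Qed.

(** If no tail infimum were positive, neither would be their limit; a positive one serves as [c]. *)
Lemma limn_einf_gt0 (v : nat -> R) : (0 < limn_einf (fun n => (v n)%:E))%E ->
  exists2 c : R, 0 < c & \forall n \near \oo, c <= v n.
Proof.
rewrite limn_einf_lim => l0; set w := einfs _ in l0.
have [m wm] : exists m, (0 < w m)%E.
  apply/not_existsP => h; move: l0; rewrite ltNge => /negP; apply.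
  apply: lime_le; first exact: is_cvg_einfs.
  by apply: nearW => m; rewrite leNgt; apply/negP; exact: h.
have wv n : (m <= n)%N -> (w m <= (v n)%:E)%E.
  by move=> mn; apply: ereal_inf_lbound; exists n.
have wfin : w m \is a fin_num.
  by rewrite ge0_fin_numE ?(ltW wm)// (le_lt_trans (wv m (leqnn _)))// ltry.
exists (fine (w m)); first by rewrite -lte_fin fineK.
by exists m => // n /= mn; rewrite -lee_fin fineK// wv.
Qed.

End asymptotics.

(** * Almost sure conclusion *)

Lemma borel_cantelli {disp : measure_display} {Omega : measurableType disp} {R : realType}
    (P : probability Omega R) (B : nat -> set Omega) :
  (forall n, measurable (B n)) -> (forall n, (P (B n) <= ((n%:R ^+ 2)^-1)%:E)%E) ->
  {ae P, forall w, \forall n \near \oo, ~ B n w}.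
Proof.
(* The exceptional null set consists of the outcomes lying in infinitely many [B n]. *)
move=> mB PB; exists (lim_sup_set B); split.
- by apply: bigcap_measurable => // n _; exact: bigcup_measurable.
- apply: lim_sup_set_cvg0 => //; apply: (@le_lt_trans _ _ 2%:E); last exact: ltry.
  apply: lime_le; first by apply: is_cvg_nneseries => n _ _; exact: measure_ge0.
  apply: nearW => m; apply: (@le_trans _ _ (\sum_(0 <= i < m) ((i%:R ^+ 2)^-1)%:E)%E).
    by apply: lee_sum => i _; exact: PB.
  by rewrite sumEFin lee_fin sum_inv_sqr_le.
- move=> w /= nw n _ /=; apply: contrapT => h; apply: nw; exists n => // m /= nm Bm.
  by apply: h; exists m.
Qed.

Theorem theorem3p6
  (disp : measure_display) (Omega : measurableType disp) (R : realType)
  (P : probability Omega R)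
  (d K : nat -> nat)
  (A : forall n, 'M[R]_(d n, K n))
  (X : forall n, 'I_(d n) -> {RV P >-> R})
  (Xs : forall n, 'I_n -> 'I_(d n) -> {RV P >-> R})
  (C : forall n, 'I_(d n) -> 'I_(d n) -> R -> R -> R)
  (HTheta : forall n, (0 < n)%N -> in_Theta_L (A n))
  (Hcont : forall n, (0 < n)%N -> continuous_margins (X n))
  (Hstdf : forall n, (0 < n)%N -> has_stdf (X n) (stdf_of (A n)))
  (Hiid : forall n, (0 < n)%N -> iid_sample (X n) (Xs n))
  (HC : forall n (j l : 'I_(d n)), (0 < n)%N -> (j < l)%N ->
    is_copula_of (X n j) (X n l) (C n j l))
  (Hd2 : forall n, (0 < n)%N -> (2 <= d n)%N)
  (Hd : (fun n => ln (d n)%:R : R) =o_\oo (fun n => n%:R : R))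
  (rho0 M0 : R) (Hrho0 : 0 < rho0) (HM0 : 0 < M0)
  (HC2 : forall n (j l : 'I_(d n)), (0 < n)%N -> (j < l)%N ->
    exists rho M : R, [/\ rho0 <= rho, 0 <= M <= M0 &
      second_order_class rho M (C n j l)])
  (Heta : (0 < limn_einf (fun n => (signal_strength (A n))%:E))%E)
  (r M : nat -> R)
  (Hr : forall n, (0 < n)%N -> rho0 <= r n)
  (HM : forall n, (0 < n)%N -> 0 < M n <= M0)
  (HrM : forall n (j l : 'I_(d n)), (0 < n)%N -> (j < l)%N ->
    second_order_class (r n) (M n) (C n j l))
  (ck ckappa : nat -> R)
  (Hck : exists lo hi : R, 0 < lo /\
    forall n, (0 < n)%N -> lo <= ck n <= hi)
  (Hckappa : exists lo hi : R, 0 < lo /\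
    forall n, (0 < n)%N -> lo <= ckappa n <= hi)
  (Hcc : forall n, (0 < n)%N ->
    M n * ck n `^ r n + 9 * ck n `^ (- 2^-1) + 5 * (ck n)^-1 <= ckappa n)
  (k : nat -> nat) (kappa : nat -> R)
  (Hk : forall n, (0 < n)%N ->
    k n = Num.truncn (ck n
      * ln (4 * (d n)%:R * n%:R ^+ 2) `^ (1 / (2 * r n + 1))
      * n%:R `^ (2 * r n / (2 * r n + 1))))
  (Hkn : \forall n \near \oo, (1 <= k n <= n)%N)
  (Hkappa : forall n, (0 < n)%N ->
    kappa n = ckappa n
      * (ln (4 * (d n)%:R * n%:R ^+ 2) / n%:R) `^ (r n / (2 * r n + 1)))
  (rk : forall n, Omega -> 'I_n -> 'I_(d n) -> nat)
  (Hrk : forall n w (j : 'I_(d n)), (0 < n)%N ->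
    is_ranking (fun i => Xs n i j w) (fun i => rk n w i j))
  (Khat : nat -> Omega -> nat)
  (jhat : forall n w, 'I_(Khat n w) -> 'I_(d n))
  (Ahat : forall n w, 'M[R]_(d n, Khat n w))
  (HPureVar : forall n w, (0 < n)%N ->
    is_PureVar (chi_hat (k n) (rk n w)) (kappa n) (jhat n w))
  (HHTSP : forall n w, (0 < n)%N ->
    is_HTSP (chi_hat (k n) (rk n w)) (kappa n) (kappa n) (jhat n w)
      (Ahat n w)) :
  {ae P, forall w, \forall n \near \oo,
    [/\ I_hat (chi_hat (k n) (rk n w)) (kappa n) (jhat n w) = pure_set (A n),
        Khat n w = K n &
        row_sparsity (Ahat n w) = row_sparsity (A n)]}
  /\
  {ae P, forall w,
    (limn_esup (fun n => loss_inf2 (Ahat n w) (A n)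
       * ((Num.sqrt (row_sparsity (A n))%:R
           * (ln (n%:R * (d n)%:R) / n%:R) `^ (r n / (2 * r n + 1)))^-1)%:E)
     < +oo)%E}.
Proof.
have [eta eta0 near_eta] := limn_einf_gt0 Heta.
have [cklo [ckhi [cklo0 ckb]]] := Hck.
have [cplo [cphi [cplo0 cpb]]] := Hckappa.
have cphi0 : 0 < cphi by have /andP[? ?] := cpb 1%N isT; lra.
pose L n : R := ln (4 * (d n)%:R * n%:R ^+ 2).
pose ex n := r n / (2 * r n + 1).
pose y n := (L n / n%:R) `^ ex n.
have r_gt0 n : (0 < n)%N -> 0 < r n by move=> /Hr; exact: lt_le_trans.
have L_ge1 n : (0 < n)%N -> 1 <= L n.
  move=> n0; rewrite -ler_expR lnK; last first.
    by rewrite posrE !mulr_gt0 ?exprn_gt0 ?ltr0n// (leq_trans _ (Hd2 _ n0)).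
  apply: (@le_trans _ _ 4); first exact: expR1_le4.
  by rewrite -natrX -!natrM ler_nat -mulnA leq_pmulr// muln_gt0 expn_gt0 n0 (leq_trans _ (Hd2 _ n0)).
(* Gathers the conditions that hold only for large n and are required by the tuning bounds and by
   exact recovery. *)
pose regular n := [/\ (0 < n)%N, (1 <= k n <= n)%N, 100 * y n ^+ 2 <= ck n,
  2 * kappa n < eta & eta <= signal_strength (A n)].
have near_regular : \forall n \near \oo, regular n.
  (* [y n <= e1] gives [100 * y n ^+ 2 <= cklo]; [y n <= e2] gives [2 * kappa n <= eta / 2]. *)
  pose e1 := Num.sqrt (cklo / 100); pose e2 := eta / (4 * cphi).
  have e10 : 0 < e1 by rewrite sqrtr_gt0 divr_gt0.
  have e20 : 0 < e2 by rewrite divr_gt0// mulr_gt0.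
  near=> n; have n0 : (0 < n)%N by near: n; exists 1%N.
  have y1 : y n <= e1 by near: n; exact: (log_rate_small Hd2 Hd Hrho0 Hr e10).
  have y2 : y n <= e2 by near: n; exact: (log_rate_small Hd2 Hd Hrho0 Hr e20).
  have y0 : 0 <= y n by exact: powR_ge0.
  split => //; [by near: n| | |by near: n].
  - have /andP[lo _] := ckb n n0; apply: le_trans lo.
    rewrite -ler_pdivlMl//.
    have -> : 100^-1 * cklo = e1 ^+ 2 by rewrite /e1 sqr_sqrtr ?divr_ge0 ?(ltW cklo0)// mulrC.
    by rewrite lerXn2r ?nnegrE// ltW.
  - rewrite Hkappa//; have /andP[clo chi] := cpb n n0.
    apply: (@le_lt_trans _ _ (2 * (cphi * e2))).
      by rewrite ler_wpM2l// ler_pM// ltW// (lt_le_trans cplo0).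
    have -> : 2 * (cphi * e2) = eta / 2 by rewrite /e2; field; rewrite gt_eqF.
    by lra.
pose close n w := forall j l : 'I_(d n),
  `|chi_hat (k n) (rk n w) j l - tail_cor (A n) j l| <= kappa n.
have : forall n, exists B : set Omega, [/\ measurable B,
    (P B <= ((n%:R ^+ 2)^-1)%:E)%E & regular n -> forall w, ~ B w -> close n w].
  move=> n; have [[n0 kn y100 _ _]|irr] := pselect (regular n); last first.
    (* Irregular n, among them [n = 0] where the bound is 0, receive the empty event. *)
    exists set0; split => //.
    by rewrite measure0 lee_fin invr_ge0 sqr_ge0.
  have N0 : 0 < n%:R :> R by rewrite ltr0n.
  have /andP[M_gt0 _] := HM n n0.
  have ck0 : 0 < ck n by have /andP[lo _] := ckb n n0; exact: lt_le_trans lo.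
  have L1 := L_ge1 n n0.
  have [kL bound] := tuning_bounds (r_gt0 n n0) L1 N0 ck0 (ltW M_gt0) (Hcc n n0) y100 (Hk n n0).
  have k0 : 0 < (k n)%:R :> R by lra.
  (* With this t the Chernoff exponent is [2 * L n], so the union bound becomes
     [2 * d ^+ 2 / (4 * d * n ^+ 2) ^+ 2], that is [1 / (8 * n ^+ 4)]. The bound [32 * L n <= k n]
     is what [t <= k / 2] requires. *)
  set t := Num.sqrt (8 * L n * (k n)%:R) in bound.
  have t2 : t ^+ 2 = 8 * L n * (k n)%:R by rewrite sqr_sqrtr// !mulr_ge0//; lra.
  have tk : 0 <= t <= (k n)%:R / 2.
    rewrite sqrtr_ge0/=; have h2 : 0 <= (k n)%:R / 2 :> R by rewrite divr_ge0.
    rewrite -[leRHS](ger0_norm h2) -sqrtr_sqr ler_wsqrtr//.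
    have -> : ((k n)%:R / 2) ^+ 2 = (4^-1 * (k n)%:R) * (k n)%:R :> R by field.
    by rewrite ler_pM2r//; lra.
  have [B [mB PB goodB]] := chi_hat_concentration_event (HTheta n n0) (Hcont n n0)
    (Hstdf n n0) (Hiid n n0) (fun j l => HC n j l n0) (fun j l => HrM n j l n0)
    (r_gt0 n n0) (ltW M_gt0) kn tk.
  exists B; split => //.
    apply: (le_trans PB); rewrite lee_fin t2.
    have -> : 8 * L n * (k n)%:R / (4 * (k n)%:R) = L n + L n :> R.
      by field; rewrite gt_eqF.
    have D0 : 0 < (d n)%:R :> R by rewrite ltr0n (leq_trans _ (Hd2 _ n0)).
    rewrite opprD expRD expRN /L lnK ?posrE ?mulr_gt0 ?exprn_gt0//.
    have -> : (d n)%:R ^+ 2 * (2 * ((4 * (d n)%:R * n%:R ^+ 2)^-1 * (4 * (d n)%:R * n%:R ^+ 2)^-1)) =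
      (8 * n%:R ^+ 2)^-1 * (n%:R ^+ 2)^-1 :> R by field; rewrite !gt_eqF.
    rewrite ler_piMl// ?invr_ge0 ?sqr_ge0// invf_le1 ?mulr_gt0 ?exprn_gt0//.
    by rewrite -natrX -natrM ler1n muln_gt0 expn_gt0 n0.
  move=> _ w Bw j l; apply: le_trans (goodB w Bw _ (fun j => Hrk n w j n0) j l) _.
  by rewrite Hkappa.
move=> /choice[B hB].
have BC : {ae P, forall w, \forall n \near \oo, ~ B n w}.
  by apply: borel_cantelli => n; case: (hB n).
have recovery w : (\forall n \near \oo, ~ B n w) -> \forall n \near \oo,
    [/\ I_hat (chi_hat (k n) (rk n w)) (kappa n) (jhat n w) = pure_set (A n),
        Khat n w = K n, row_sparsity (Ahat n w) = row_sparsity (A n) &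
        (loss_inf2 (Ahat n w) (A n) <=
          (2 * kappa n * Num.sqrt (row_sparsity (A n))%:R)%:E)%E].
  move=> Bw; near=> n.
  have reg : regular n by near: n.
  have nB : ~ B n w by near: n.
  have [_ _ /(_ reg w nB) cl] := hB n; have [n0 _ _ hk he] := reg.
  exact: (HTSP_exact_recovery (HTheta n n0) he hk cl (HPureVar n w n0) (HHTSP n w n0)).
split; apply: filterS BC => w /recovery rec.
  by apply: filterS rec => n [].
(* The constant is the 2 of the recovery bound times [cphi] for [ckappa n] times the 3 of
   [log_ratio_compare]. *)
apply: (@limn_esup_lty _ _ (6 * cphi)); near=> n.
have n1 : (1 < n)%N by near: n; exists 2%N.
have n0 : (0 < n)%N by exact: ltnW.
have [_ _ _ le] : [/\ I_hat (chi_hat (k n) (rk n w)) (kappa n) (jhat n w) = pure_set (A n),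
        Khat n w = K n, row_sparsity (Ahat n w) = row_sparsity (A n) &
        (loss_inf2 (Ahat n w) (A n) <=
          (2 * kappa n * Num.sqrt (row_sparsity (A n))%:R)%:E)%E] by near: n.
have N0 : 0 < n%:R :> R by rewrite ltr0n.
have e01 : 0 <= ex n <= 1.
  have := r_gt0 n n0 => r0; rewrite /ex divr_ge0 ?ler_pdivrMr /=; lra.
have lnd : 0 < ln (n%:R * (d n)%:R) :> R.
  by rewrite ln_gt0// -natrM ltr1n (leq_trans n1)// leq_pmulr// (leq_trans _ (Hd2 _ n0)).
(* A row summing to 1 has non-empty support, so the normalizing factor is positive and its inverse
   is a genuine one. *)
have s0 : 0 < Num.sqrt (row_sparsity (A n))%:R :> R.
  have d0 := leq_trans (isT : (0 < 2)%N) (Hd2 _ n0).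
  rewrite sqrtr_gt0 ltr0n (leq_trans (row_support_neq0 (HTheta n n0) (Ordinal d0)))//.
  exact: (leq_bigmax (Ordinal d0)).
set s := Num.sqrt _ in le s0 *; set v := (ln (n%:R * _) / _) `^ _.
have v0 : 0 < v by rewrite powR_gt0// divr_gt0.
have yv : y n <= 3 * v by exact: log_ratio_compare (Hd2 _ n0) n0 e01.
have sv0 : 0 < s * v by rewrite mulr_gt0.
apply: (@le_trans _ _ ((2 * kappa n * s)%:E * ((s * v)^-1)%:E)%E).
  by rewrite lee_wpmul2r// lee_fin invr_ge0 ltW.
rewrite -EFinM lee_fin ler_pdivrMr// Hkappa//.
have /andP[clo chi] := cpb n n0.
have -> : 6 * cphi * (s * v) = 2 * (cphi * (3 * v)) * s by ring.
rewrite ler_pM2r// ler_pM2l// ler_pM ?powR_ge0//.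
by rewrite (le_trans _ clo)// ltW.
Unshelve. all: by end_near. Qed.
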